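(* Let $(H,\alpha)$ be a monoidal Hom-Hopf algebra and let $A\subset B$ be a right $H$-extension, that is, $(B,\beta)$ is a right $(H,\alpha)$-Hom-comodule algebra and $A=B^{coH}$. Then $A\subset B$ is $H$-Galois with the normal bases property if and only if $B\cong A\#_{\sigma}H$ for some crossed product $A\#_{\sigma}H$ of $A$ with $H$, where $\cong$ means that there is a bijective Hom-algebra map $A\#_\sigma H\to B$ which is both a left $A$-module map and a right $H$-comodule map.
   Context: All vector spaces, tensor products and linear maps are over a fixed field $k$. Sweedler notation: $\Delta(h)=\sum h_1\otimes h_2$, $\sum h_1\otimes\Delta(h_2)=\sum h_1\otimes h_{21}\otimes h_{22}$, etc. A Hom-algebra $(A,\beta)$ is a vector space $A$ with a linear automorphism $\beta$, an element $1\in A$ and a linear map $A\otimes A\to A$, $a\otimes b\mapsto ab$, such that $\beta(a)(bc)=(ab)\beta(c)$, $a1=\beta(a)=1a$, $\beta(ab)=\beta(a)\beta(b)$, $\beta(1)=1$; the element $1$ is called the identity. A Hom-algebra map is a linear map commuting with the automorphisms and preserving products and identities. The tensor product of Hom-algebras is a Hom-algebra with componentwise product and the tensor product automorphism. A Hom-coalgebra $(C,\gamma)$ is a vector space with a linear automorphism $\gamma$ and linear maps $\Delta:C\to C\otimes C$, $\varepsilon:C\to k$ such that $\sum\gamma^{-1}(c_1)\otimes\Delta(c_2)=\sum\Delta(c_1)\otimes\gamma^{-1}(c_2)$, $\sum c_1\varepsilon(c_2)=\sum\varepsilon(c_1)c_2=\gamma^{-1}(c)$, $\Delta(\gamma(c))=\sum\gamma(c_1)\otimes\gamma(c_2)$,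 $\varepsilon(\gamma(c))=\varepsilon(c)$. A monoidal Hom-Hopf algebra $(H,\alpha)$ is a vector space with linear automorphism $\alpha$ that is both a Hom-algebra and a Hom-coalgebra, with $\Delta(gh)=\Delta(g)\Delta(h)$, $\Delta(1)=1\otimes1$, $\varepsilon(gh)=\varepsilon(g)\varepsilon(h)$, $\varepsilon(1)=1$, and with a linear map $S:H\to H$ such that $S\circ\alpha=\alpha\circ S$ and $\sum S(h_1)h_2=\varepsilon(h)1=\sum h_1S(h_2)$. A left $(A,\beta)$-Hom-module is a vector space $M$ with linear automorphism $\mu$ and a linear map $A\otimes M\to M$, $a\otimes m\mapsto am$, with $\beta(a)(bm)=(ab)\mu(m)$, $1m=\mu(m)$, $\mu(am)=\beta(a)\mu(m)$; right Hom-modules are defined similarly. Left $A$-module maps are linear maps commuting with the action and with the automorphisms. A right $(H,\alpha)$-Hom-comodule is a vector space $M$ with linear automorphism $\mu$ and a linear map $\rho:M\to M\otimes H$, $m\mapsto\sum m_{(0)}\otimes m_{(1)}$, with $\sum\mu^{-1}(m_{(0)})\otimes\Delta(m_{(1)})=\sum\rho(m_{(0)})\otimes\alpha^{-1}(m_{(1)})$, $\sum\varepsilon(m_{(1)})m_{(0)}=\mu^{-1}(m)$, $\rho(\mu(m))=\sum\mu(m_{(0)})\otimes\alpha(m_{(1)})$. Right $H$-comodule maps $g:M\to N$ are linear maps commuting with the automorphisms and satisfying $\rho_N\circ g=(g\otimes id)\circ\rho_M$. A right $(H,\alpha)$-Hom-comodule algebra is a Hom-algebra $(B,\beta)$ with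 a right $(H,\alpha)$-Hom-comodule structure $\rho:B\to B\otimes H$ that is a Hom-algebra map. Its coinvariants are $B^{coH}=\{b\in B:\rho(b)=\beta^{-1}(b)\otimes 1\}$, a Hom-algebra with the restriction of $\beta$; $B$ is a left and right $A=B^{coH}$-module by multiplication. Tensor product over $A$: for a right Hom-module $(M,\mu)$ and left Hom-module $(N,\lambda)$ over $A$, $M\otimes_AN$ is the quotient of $M\otimes N$ by the subspace spanned by all $m\cdot a\otimes n-\mu(m)\otimes a\cdot\lambda^{-1}(n)$, $m\in M$, $n\in N$, $a\in A$. Galois: $A=B^{coH}\subset B$ is (right) $H$-Galois if the linear map $\varphi:B\otimes_AB\to B\otimes H$, $\varphi(a\otimes b)=\sum\beta^{-1}(a)b_{(0)}\otimes\alpha(b_{(1)})$, is bijective. Normal bases property: $B\cong A\otimes H$ as left $A$-modules and right $H$-comodules (a single isomorphism which is both a left $A$-module map and a right $H$-comodule map), where $A\otimes H$ has automorphism $\beta\otimes\alpha$, left action $a\cdot(b\otimes h)=\beta^{-1}(a)b\otimes\alpha(h)$ and right coaction $a\otimes h\mapsto\sum(\beta^{-1}(a)\otimes h_1)\otimes\alpha(h_2)$. Weak action: $H$ weakly acts on $A$ if there is a linear map $H\otimes A\to A$, $h\otimes a\mapsto h\cdot a$, with $\beta(h\cdot a)=\alpha(h)\cdot\beta(a)$, $h\cdot1=\varepsilon(h)1$, $h\cdot(ab)=\sum(h_1\cdot a)(h_2\cdot b)$. Crossed product: given a weak action of $H$ on $A$ and a convolution invertible linear map $\sigma:H\otimes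 H\to A$ (i.e. there is a linear $\sigma^{-1}$ with $\sum\sigma(h_1,l_1)\sigma^{-1}(h_2,l_2)=\varepsilon(h)\varepsilon(l)1=\sum\sigma^{-1}(h_1,l_1)\sigma(h_2,l_2)$), $A\#_\sigma H$ is the vector space $A\otimes H$ (elements $a\#h$) with multiplication $$(a\#h)(b\#k)=\sum a[(\alpha^{-1}(h_{1})\cdot\beta^{-2}(b))\sigma(h_{21},\alpha^{-1}(k_{1}))]\#\alpha^{2}(h_{22})\alpha(k_{2}),$$ and it is required that $(A\#_\sigma H,\beta\otimes\alpha)$ is a Hom-algebra with identity $1\#1$. Its left $A$-action is $a\cdot(b\#h)=\beta^{-1}(a)b\#\alpha(h)$ and its right $H$-coaction is $a\#h\mapsto\sum(\beta^{-1}(a)\#h_1)\otimes\alpha(h_2)$. *)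

(* Defs.v *)
From HB Require Import structures.
From mathcomp Require Import all_boot all_algebra.
From mathcomp Require Import boolp.
From mathcomp.multinomials Require Import freeg.

Set Implicit Arguments.
Unset Strict Implicit.
Unset Printing Implicit Defensive.

Import GRing.Theory.
Local Open Scope ring_scope.
Local Open Scope quotient_scope.

(* Quotient of a vector space V by the subspace spanned by S. Membership in   *)
(* the span is made boolean classically.                                      *)
Section Span.
Variables (k : fieldType) (V : lmodType k) (S : V -> Prop).

Inductive span : V -> Prop :=
| span0 : span 0
| spanZD (c : k) (u v : V) : S u -> span v -> span (c *: u + v).

Lemma spanD u v : span u -> span v -> span (u + v).
Proof.
elim=> [|c s w Ss _ IH] Sv; first by rewrite add0r.
by rewrite -addrA; apply: spanZD => //; exact: IH.
Qed.

Lemma spanZ c u : span u -> span (c *: u).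
Proof.
elim=> [|d s w Ss _ IH]; first by rewrite scaler0; exact: span0.
by rewrite scalerDr scalerA; exact: spanZD.
Qed.

Lemma mem_span u : S u -> span u.
Proof.
by move=> Su; rewrite -[u]addr0 -[u]scale1r; apply: spanZD => //; exact: span0.
Qed.

Definition spanb : V -> bool := fun v => `[< span v >].

Lemma spanb_zmod_closed : zmod_closed spanb.
Proof.
split=> [|u v /asboolP Su /asboolP Sv]; apply/asboolP; first exact: span0.
by apply: spanD => //; rewrite -scaleN1r; exact: spanZ.
Qed.

Definition span_zmodClosed : zmodClosed V :=
  HB.pack spanb (GRing.isZmodClosed.Build V spanb spanb_zmod_closed).

Definition quot : Type := Quotient.quot span_zmodClosed.
HB.instance Definition _ := GRing.Zmodule.on quot.

Definition qproj (v : V) : quot := \pi_quot v.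
Definition qrepr (x : quot) : V := repr x.

Lemma qreprK : cancel qrepr qproj. Proof. exact: reprK. Qed.

Lemma qprojP u v : qproj u = qproj v <-> span (u - v).
Proof.
split.
  by move/eqP; rewrite -(Quotient.idealrBE span_zmodClosed) => /asboolP.
move=> Suv; apply/eqP; rewrite -(Quotient.idealrBE span_zmodClosed).
exact/asboolP.
Qed.

Lemma qprojD u v : qproj (u + v) = qproj u + qproj v.
Proof. by rewrite /qproj !piE. Qed.

Definition qscale c (x : quot) : quot := qproj (c *: qrepr x).

Lemma qprojZ c v : qproj (c *: v) = qscale c (qproj v).
Proof.
apply/qprojP; rewrite -scalerBr; apply: spanZ; apply/qprojP.
by rewrite qreprK.
Qed.

Fact qscaleA a b v : qscale a (qscale b v) = qscale (a * b) v.
Proof. by rewrite -[v]qreprK -!qprojZ scalerA. Qed.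
Fact qscale1 : left_id 1 qscale.
Proof. by move=> v; rewrite -[v]qreprK -!qprojZ scale1r. Qed.
Fact qscaleDr : right_distributive qscale +%R.
Proof.
move=> a u v; rewrite -[u]qreprK -[v]qreprK -qprojD -!qprojZ.
by rewrite -qprojD scalerDr.
Qed.
Fact qscaleDl v : {morph qscale^~ v : a b / a + b}.
Proof. by move=> a b; rewrite -[v]qreprK -!qprojZ -qprojD scalerDl. Qed.

HB.instance Definition _ :=
  GRing.Zmodule_isLmodule.Build k quot qscaleA qscale1 qscaleDr qscaleDl.

Fact qproj_linear : linear qproj.
Proof. by move=> c u v; rewrite qprojD qprojZ. Qed.

HB.instance Definition _ := GRing.isLinear.Build k V quot *:%R qproj qproj_linear.

End Span.

(* M \ox N is the free vector space on M * N modulo bilinearity. A linear map  *)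
(* M \ox N -> P determined by its values on the m \ox n (products, actions,    *)
(* cocycles) is given below as a bilinear map {bilinear M -> N -> P}.         *)
Inductive tensor_rel (k : fieldType) (M N : lmodType k) : {freeg (M * N) / k} -> Prop :=
| tensor_relDl (c : k) (m m' : M) (n : N) :
    tensor_rel (<< (c *: m + m', n) >> - (c *: << (m, n) >> + << (m', n) >>))
| tensor_relDr (c : k) (m : M) (n n' : N) :
    tensor_rel (<< (m, c *: n + n') >> - (c *: << (m, n) >> + << (m, n') >>)).

Definition tensor (k : fieldType) (M N : lmodType k) : Type := quot (@tensor_rel k M N).

HB.instance Definition _ (k : fieldType) (M N : lmodType k) := GRing.Lmodule.on (tensor M N).

Section TensorTheory.
Variables (k : fieldType) (M N P : lmodType k).

Definition tens (m : M) (n : N) : tensor M N := qproj (@tensor_rel k M N) << (m, n) >>.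

Fact tens_bilinear : bilinear_for *:%R *:%R tens.
Proof.
rewrite /tens; split=> [n c m m'|m c n n']; rewrite -qproj_linear;
  apply/qprojP/mem_span; [exact: tensor_relDl | exact: tensor_relDr].
Qed.

HB.instance Definition _ :=
  bilinear_isBilinear.Build k M N (tensor M N) *:%R *:%R tens tens_bilinear.

Definition tsum (F : M -> N -> P) (t : tensor M N) : P :=
  fglift (fun p => F p.1 p.2) (qrepr t).

Fact fglift_linear (F : M * N -> P) : linear (fglift F : {freeg (M * N) / k} -> P).
Proof.
pose f : {additive {freeg (M * N) / k} -> P} :=
  HB.pack (fglift F) (GRing.isZmodMorphism.Build _ _ (fglift F) (lift_is_additive F)).
move=> c u v; rewrite -![fglift F _]/(f _) raddfD; congr (_ + _).
rewrite -[in RHS](freeg_sumE u) [c *: u]/(fgscale c u) /fgscale !raddf_sum.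
by apply: eq_bigr => i _; rewrite /f /= !liftU scalerA.
Qed.

Lemma tsumE (F : M -> N -> P) (u : {freeg (M * N) / k}) :
  bilinear_for *:%R *:%R F ->
  tsum F (qproj _ u) = fglift (fun p => F p.1 p.2) u.
Proof.
case=> Fl Fr; rewrite /tsum; set f := fglift _.
have fP : linear f by exact: fglift_linear.
pose g : {linear {freeg (M * N) / k} -> P} :=
  HB.pack f (GRing.isLinear.Build _ _ _ _ f fP).
rewrite -![f _]/(g _); apply/eqP; rewrite -subr_eq0 -linearB; apply/eqP.
have : span (@tensor_rel k M N) (qrepr (qproj (@tensor_rel k M N) u) - u).
  by apply/qprojP; rewrite qreprK.
elim=> [|c _ w [d m m' n|d m n n'] _ IH]; first by rewrite linear0.
  rewrite linearP IH addr0 linearB linearP /g /= /f !liftU /=.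
  by rewrite !scale1r Fl subrr scaler0.
rewrite linearP IH addr0 linearB linearP /g /= /f !liftU /=.
by rewrite !scale1r Fr subrr scaler0.
Qed.

Lemma tsum_tens (F : M -> N -> P) m n :
  bilinear_for *:%R *:%R F -> tsum F (tens m n) = F m n.
Proof. by move=> FP; rewrite tsumE // liftU scale1r. Qed.

Lemma tsum_linear (F : M -> N -> P) :
  bilinear_for *:%R *:%R F -> linear (tsum F).
Proof.
move=> FP c t u; rewrite -[t]qreprK -[u]qreprK -linearP !tsumE //.
exact: fglift_linear.
Qed.

Lemma eq_tsum (F G : M -> N -> P) t :
  (forall m n, F m n = G m n) -> tsum F t = tsum G t.
Proof. by move=> FG; congr (tsum _ t); do 2!apply/funext=> ?. Qed.

Lemma tens_ind (Q : tensor M N -> Prop) :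
  Q 0 -> (forall m n t, Q t -> Q (tens m n + t)) -> forall t, Q t.
Proof.
move=> Q0 Qt t; rewrite -[t]qreprK -[qrepr t]freeg_sumE linear_sum /=.
elim: (dom _) => [|[m n] s IH]; first by rewrite big_nil.
rewrite big_cons; set c := coeff _ _.
have -> : qproj _ << c *g (m, n) >> = tens (c *: m) n :> tensor M N; last exact: Qt.
rewrite linearZl_LR /= /tens -linearZ /=; congr qproj.
by apply/eqP/freeg_eqP => x; rewrite coeffZ !coeffU mul1r.
Qed.

Lemma eq_tensor (f g : tensor M N -> P) : linear f -> linear g ->
  (forall m n, f (tens m n) = g (tens m n)) -> f =1 g.
Proof.
move=> fP gP fg; pose f' : {linear tensor M N -> P} :=
  HB.pack f (GRing.isLinear.Build _ _ _ _ f fP).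
pose g' : {linear tensor M N -> P} :=
  HB.pack g (GRing.isLinear.Build _ _ _ _ g gP).
suff : f' =1 g' by [].
apply: tens_ind => [|m n t IH]; first by rewrite !linear0.
by rewrite !linearD IH; congr (_ + _); exact: fg.
Qed.

Lemma tsum_param (X : lmodType k) (F : X -> M -> N -> P) t :
  (forall m n, linear (fun x => F x m n)) -> linear (fun x => tsum (F x) t).
Proof.
move=> Fl c x y; rewrite /tsum; unlock fglift; rewrite /lift /prelift.
rewrite scaler_sumr -big_split /=; apply: eq_bigr => i _.
by rewrite Fl scalerDr !scalerA mulrC.
Qed.

End TensorTheory.

Arguments tens {k M N}.
Arguments tsum {k M N P}.

Notation "x \ox y" := (tens x y) (at level 45, left associativity) : ring_scope.

(* Sweedler notation: if t = sum_i x_i \ox y_i and F is bilinear, then        *)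
(* \tsum_(x, y <- t) F x y = sum_i F x_i y_i, by tsum_tens and tsum_linear.   *)
(* The operator is total: it sums F over a chosen representative of t, so it  *)
(* is meaningful only for bilinear F.                                         *)
Notation "\tsum_ ( x , y <- t ) F" := (tsum (fun x y => F) t)
  (at level 46, F at level 46, x name, y name,
   format "'[' \tsum_ ( x ,  y  <-  t ) '/  '  F ']'") : ring_scope.

Section TensorMaps.
Variables (k : fieldType).
Implicit Types (M N P Q : lmodType k).

Lemma linear_tsum M N P Q (f : {linear P -> Q}) (F : M -> N -> P) t :
  f (tsum F t) = \tsum_(x, y <- t) f (F x y).
Proof.
rewrite /tsum; unlock fglift; rewrite /lift /prelift linear_sum /=.
by apply: eq_bigr => i _; rewrite linearZ.
Qed.

Lemma tsum_comp_linear M N P Q (F : M -> N -> P) (f : Q -> tensor M N) :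
  bilinear_for *:%R *:%R F -> linear f -> linear (fun x => tsum F (f x)).
Proof. by move=> FP fP c x y; rewrite fP tsum_linear. Qed.

Lemma tsum_tsum M N M' N' P (G : M' -> N' -> P) (K : M -> N -> tensor M' N') t :
  bilinear_for *:%R *:%R G ->
  tsum G (tsum K t) = \tsum_(x, y <- t) tsum G (K x y).
Proof.
move=> /tsum_linear GP.
exact: (linear_tsum (HB.pack (tsum G) (GRing.isLinear.Build _ _ _ _ _ GP))).
Qed.

Lemma tsum2_bilinear M N M' N' P (F : M -> N -> M' -> N' -> P) :
  (forall b c d, linear (fun a => F a b c d)) ->
  (forall a c d, linear (fun b => F a b c d)) ->
  (forall a b d, linear (fun c => F a b c d)) ->
  (forall a b c, linear (fun d => F a b c d)) ->
  bilinear_for *:%R *:%R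
    (fun x y => \tsum_(a, b <- x) \tsum_(c, d <- y) F a b c d).
Proof.
move=> Fa Fb Fc Fd; split=> [y|x].
  by apply: tsum_linear; split=> ?; apply: tsum_param.
by apply: tsum_param => a b; apply: tsum_linear.
Qed.

Definition tmap M N P Q (f : M -> P) (g : N -> Q) (t : tensor M N) : tensor P Q :=
  \tsum_(x, y <- t) (f x \ox g y).

Fact tmap_bilinear M N P Q (f : {linear M -> P}) (g : {linear N -> Q}) :
  bilinear_for *:%R *:%R (fun x y => f x \ox g y).
Proof. by split=> u c x y /=; rewrite linearP (linearPl, linearPr). Qed.

Lemma tmapE M N P Q (f : {linear M -> P}) (g : {linear N -> Q}) x y :
  tmap f g (x \ox y) = f x \ox g y.
Proof. by rewrite /tmap tsum_tens //; exact: tmap_bilinear. Qed.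

Fact tmap_linear M N P Q (f : {linear M -> P}) (g : {linear N -> Q}) :
  linear (tmap f g).
Proof. by apply: tsum_linear; exact: tmap_bilinear. Qed.

HB.instance Definition _ M N P Q (f : {linear M -> P}) (g : {linear N -> Q}) :=
  GRing.isLinear.Build k (tensor M N) (tensor P Q) *:%R (tmap f g) (tmap_linear f g).

End TensorMaps.

(* The inverse is uniquely determined; it is a field so that mu^-1 is a term. *)
Record linAut (k : fieldType) (V : lmodType k) := LinAut {
  aut :> {linear V -> V};
  ainv : {linear V -> V};
  autK : cancel aut ainv;
  ainvK : cancel ainv aut }.

Section TensorAut.
Variables (k : fieldType) (V W : lmodType k) (mu : linAut V) (nu : linAut W).

Fact tens_autK : cancel (tmap mu nu) (tmap (ainv mu) (ainv nu)).
Proof.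
apply: tens_ind => [|x y t IH]; first by rewrite !linear0.
by rewrite !linearD /= IH !tmapE !autK.
Qed.

Fact tens_ainvK : cancel (tmap (ainv mu) (ainv nu)) (tmap mu nu).
Proof.
apply: tens_ind => [|x y t IH]; first by rewrite !linear0.
by rewrite !linearD /= IH !tmapE !ainvK.
Qed.

Definition tens_aut : linAut (tensor V W) := LinAut tens_autK tens_ainvK.
End TensorAut.

(* The data are separated from the axioms because the crossed product is a    *)
(* Hom-algebra only for suitable weak actions and cocycles.                   *)
Record homAlgData (k : fieldType) := HomAlgData {
  ha_sort :> lmodType k;
  ha_aut : linAut ha_sort;
  ha_mul : {bilinear ha_sort -> ha_sort -> ha_sort};
  ha_one : ha_sort }.

Arguments ha_aut {k} _.
Arguments ha_mul {k _}.
Arguments ha_one {k} _.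

Notation "x \mul y" := (ha_mul x y) (at level 40, left associativity) : ring_scope.

Record is_hom_alg (k : fieldType) (A : homAlgData k) : Prop := IsHomAlg {
  hmulA : forall a b c : A, ha_aut A a \mul (b \mul c) = (a \mul b) \mul ha_aut A c;
  hmul1 : forall a : A, a \mul ha_one A = ha_aut A a;
  h1mul : forall a : A, ha_one A \mul a = ha_aut A a;
  haut_mul : forall a b : A, ha_aut A (a \mul b) = ha_aut A a \mul ha_aut A b;
  haut1 : ha_aut A (ha_one A) = ha_one A }.

Record homAlg (k : fieldType) := HomAlg {
  ha_data :> homAlgData k;
  homAlgP :> is_hom_alg ha_data }.

Record is_hom_alg_map (k : fieldType) (A B : homAlgData k) (f : {linear A -> B}) :
    Prop := IsHomAlgMap {
  hmap_aut : forall a, f (ha_aut A a) = ha_aut B (f a);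
  hmap_mul : forall a b, f (a \mul b) = f a \mul f b;
  hmap1 : f (ha_one A) = ha_one B }.

Section TensorAlg.
Variables (k : fieldType) (A B : homAlgData k).

Definition tens_mul (x y : tensor A B) : tensor A B :=
  \tsum_(a, b <- x) \tsum_(c, d <- y) ((a \mul c) \ox (b \mul d)).

Fact tens_mul_bilinear : bilinear_for *:%R *:%R tens_mul.
Proof.
by apply: tsum2_bilinear => ? ? ? ? ? ? /=;
  rewrite (linearPl, linearPr) (linearPl, linearPr).
Qed.

HB.instance Definition _ :=
  bilinear_isBilinear.Build k (tensor A B) (tensor A B) (tensor A B)
    *:%R *:%R tens_mul tens_mul_bilinear.

Lemma tens_mulE a b c d : tens_mul (a \ox b) (c \ox d) = (a \mul c) \ox (b \mul d).
Proof.
have FP (y : tensor A B) : bilinear_for *:%R *:%R (fun (a : A) (b : B) =>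
    \tsum_(c, d <- y) ((a \mul c) \ox (b \mul d))).
  by split=> u; apply: tsum_param => ? ? ? ? ? /=;
    rewrite (linearPl, linearPr) (linearPl, linearPr).
have GP : bilinear_for *:%R *:%R (fun (c : A) (d : B) => (a \mul c) \ox (b \mul d)).
  by split=> ? ? ? ? /=; rewrite linearPr (linearPl, linearPr).
by rewrite /tens_mul (tsum_tens _ _ (FP _)) (tsum_tens _ _ GP).
Qed.

Definition tens_alg : homAlgData k :=
  HomAlgData (tens_aut (ha_aut A) (ha_aut B)) tens_mul (ha_one A \ox ha_one B).

End TensorAlg.

(* The two sides of coassociativity, in C \ox (C \ox C) and (C \ox C) \ox C,   *)
(* are compared after rebracketing the former to the left.                    *)
Record is_hom_coalg (k : fieldType) (C : lmodType k) (gamma : linAut C)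
    (Delta : {linear C -> tensor C C}) (eps : {scalar C}) : Prop := IsHomCoalg {
  hcoassoc : forall c,
    \tsum_(c1, c2 <- Delta c) \tsum_(c21, c22 <- Delta c2)
      ((ainv gamma c1 \ox c21) \ox c22)
    = \tsum_(c1, c2 <- Delta c) (Delta c1 \ox ainv gamma c2);
  hcounitr : forall c, \tsum_(c1, c2 <- Delta c) (eps c2 *: c1) = ainv gamma c;
  hcounitl : forall c, \tsum_(c1, c2 <- Delta c) (eps c1 *: c2) = ainv gamma c;
  hcomul_aut : forall c,
    Delta (gamma c) = \tsum_(c1, c2 <- Delta c) (gamma c1 \ox gamma c2);
  hcounit_aut : forall c, eps (gamma c) = eps c }.

Record homHopf (k : fieldType) := HomHopf {
  hopf_alg :> homAlg k;
  comul : {linear hopf_alg -> tensor hopf_alg hopf_alg};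
  counit : {scalar hopf_alg};
  antipode : {linear hopf_alg -> hopf_alg};
  hopf_coalg : is_hom_coalg (ha_aut hopf_alg) comul counit;
  comul_mul : forall g h, comul (g \mul h) = tens_mul (comul g) (comul h);
  comul1 : comul (ha_one hopf_alg) = ha_one hopf_alg \ox ha_one hopf_alg;
  counit_mul : forall g h, counit (g \mul h) = counit g * counit h;
  counit1 : counit (ha_one hopf_alg) = 1;
  antipode_aut : forall h,
    antipode (ha_aut hopf_alg h) = ha_aut hopf_alg (antipode h);
  antipodel : forall h, \tsum_(h1, h2 <- comul h) (antipode h1 \mul h2)
                        = counit h *: ha_one hopf_alg;
  antipoder : forall h, \tsum_(h1, h2 <- comul h) (h1 \mul antipode h2)
                        = counit h *: ha_one hopf_alg }.

Arguments comul {k} _.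
Arguments counit {k} _.
Arguments antipode {k} _.

Section Modules.
Variables (k : fieldType) (A : homAlg k).

Record homLmod := HomLmod {
  lm_sort :> lmodType k;
  lm_aut : linAut lm_sort;
  lm_act : {bilinear A -> lm_sort -> lm_sort};
  lm_actA : forall a b m,
    lm_act (ha_aut A a) (lm_act b m) = lm_act (a \mul b) (lm_aut m);
  lm_act1 : forall m, lm_act (ha_one A) m = lm_aut m;
  lm_aut_act : forall a m, lm_aut (lm_act a m) = lm_act (ha_aut A a) (lm_aut m) }.

Record homRmod := HomRmod {
  rm_sort :> lmodType k;
  rm_aut : linAut rm_sort;
  rm_act : {bilinear rm_sort -> A -> rm_sort};
  rm_actA : forall m a b,
    rm_act (rm_act m a) (ha_aut A b) = rm_act (rm_aut m) (a \mul b);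
  rm_act1 : forall m, rm_act m (ha_one A) = rm_aut m;
  rm_aut_act : forall m a, rm_aut (rm_act m a) = rm_act (rm_aut m) (ha_aut A a) }.

Record is_lmod_map (M N : homLmod) (f : {linear M -> N}) : Prop := IsLmodMap {
  lmod_map_aut : forall m, f (lm_aut M m) = lm_aut N (f m);
  lmod_map_act : forall a m, f (lm_act M a m) = lm_act N a (f m) }.

(* The Hom-version of the tensor product over A: the relation twists both     *)
(* factors, m a \ox n ~ mu(m) \ox a lambda^-1(n).                             *)
Inductive tens_over_rel (M : homRmod) (N : homLmod) : tensor M N -> Prop :=
  TensOverRel m a n : tens_over_rel
    (rm_act M m a \ox n - rm_aut M m \ox lm_act N a (ainv (lm_aut N) n)).

Definition tens_over (M : homRmod) (N : homLmod) : Type :=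
  quot (@tens_over_rel M N).

HB.instance Definition _ M N := GRing.Lmodule.on (tens_over M N).

End Modules.

Arguments lm_aut {k A} _.
Arguments lm_act {k A _}.
Arguments rm_aut {k A} _.
Arguments rm_act {k A _}.

Section Comodules.
Variables (k : fieldType) (H : homHopf k).
Local Notation alpha := (ha_aut H).

(* Coassociativity is stated in (M \ox H) \ox H, as for coalgebras.          *)
Record is_hom_comod (M : lmodType k) (mu : linAut M)
    (rho : {linear M -> tensor M H}) : Prop := IsHomComod {
  coact_coassoc : forall m,
    \tsum_(m0, m1 <- rho m) \tsum_(h1, h2 <- comul H m1)
      ((ainv mu m0 \ox h1) \ox h2)
    = \tsum_(m0, m1 <- rho m) (rho m0 \ox ainv alpha m1);
  coact_counit : forall m,
    \tsum_(m0, m1 <- rho m) (counit H m1 *: m0) = ainv mu m;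
  coact_aut : forall m,
    rho (mu m) = \tsum_(m0, m1 <- rho m) (mu m0 \ox alpha m1) }.

Record homComod := HomComod {
  cm_sort :> lmodType k;
  cm_aut : linAut cm_sort;
  cm_coact : {linear cm_sort -> tensor cm_sort H};
  homComodP : is_hom_comod cm_aut cm_coact }.

Record is_comod_map (M N : homComod) (g : {linear M -> N}) : Prop := IsComodMap {
  comod_map_aut : forall m, g (cm_aut M m) = cm_aut N (g m);
  comod_map_coact : forall m,
    cm_coact N (g m) = \tsum_(m0, m1 <- cm_coact M m) (g m0 \ox m1) }.

Record homComodAlg := HomComodAlg {
  ca_alg :> homAlg k;
  coact : {linear ca_alg -> tensor ca_alg H};
  coact_comod : is_hom_comod (ha_aut ca_alg) coact;
  coact_alg_map : @is_hom_alg_map k ca_alg (tens_alg ca_alg H) coact }.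

Definition ca_comod (B : homComodAlg) : homComod := HomComod (coact_comod B).

End Comodules.

Arguments coact {k H} _.

Section Coinvariants.
Variables (k : fieldType) (H : homHopf k) (B : homComodAlg H).
Local Notation alpha := (ha_aut H).
Local Notation beta := (ha_aut B).

Definition coinv_pred : {pred B} :=
  [pred b | coact B b == ainv beta b \ox ha_one H].

Record coinv := Coinv { coinv_val : B; _ : coinv_val \in coinv_pred }.

HB.instance Definition _ := [isSub for coinv_val].
HB.instance Definition _ := [Choice of coinv by <:].

Fact coinv_closed : subsemimod_closed coinv_pred.
Proof.
split; first split.
- by rewrite !inE !linear0 linear0l.
- by move=> x y; rewrite !inE => /eqP xP /eqP yP; rewrite !linearD /= xP yP linearDl.
- by move=> c x; rewrite !inE => /eqP xP; rewrite !linearZ /= xP linearZl_LR.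
Qed.

HB.instance Definition _ :=
  GRing.SubChoice_isSubLmodule.Build k B coinv_pred coinv coinv_closed.

Lemma coinvP (a : coinv) : coact B (val a) = ainv beta (val a) \ox ha_one H.
Proof. exact/eqP/(valP a). Qed.

Lemma coact1 : coact B (ha_one B) = ha_one B \ox ha_one H.
Proof. exact: hmap1 (coact_alg_map B). Qed.

Lemma coact_mul (a b : B) : coact B (a \mul b) = tens_mul (coact B a) (coact B b).
Proof. exact: hmap_mul (coact_alg_map B) a b. Qed.

Lemma coact_autE b : coact B (beta b) = tens_aut beta alpha (coact B b).
Proof. exact: hmap_aut (coact_alg_map B) b. Qed.

Lemma ainv1 (A : homAlg k) : ainv (ha_aut A) (ha_one A) = ha_one A.
Proof. by rewrite -{1}(haut1 A) autK. Qed.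

Lemma ainv_mul (A : homAlg k) (a b : A) :
  ainv (ha_aut A) (a \mul b) = ainv (ha_aut A) a \mul ainv (ha_aut A) b.
Proof. by apply: (can_inj (autK (ha_aut A))); rewrite (haut_mul A) !ainvK. Qed.

Fact coinv_aut_subproof a : a \in coinv_pred -> beta a \in coinv_pred.
Proof.
rewrite !inE => /eqP aP.
by rewrite coact_autE aP /= tmapE ainvK autK (haut1 H).
Qed.

Fact coinv_ainv_subproof a : a \in coinv_pred -> ainv beta a \in coinv_pred.
Proof.
rewrite !inE => /eqP aP; apply/eqP/(can_inj (autK (tens_aut beta alpha))).
by rewrite -coact_autE ainvK aP /= tmapE ainvK (haut1 H).
Qed.

Fact coinv_mul_subproof a b :
  a \in coinv_pred -> b \in coinv_pred -> a \mul b \in coinv_pred.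
Proof.
rewrite !inE => /eqP aP /eqP bP.
by rewrite coact_mul aP bP tens_mulE -ainv_mul (hmul1 H) (haut1 H).
Qed.

Fact coinv_one_subproof : ha_one B \in coinv_pred.
Proof. by rewrite inE coact1 ainv1. Qed.

Definition coinv_autf (a : coinv) : coinv := Coinv (coinv_aut_subproof (valP a)).
Definition coinv_ainvf (a : coinv) : coinv := Coinv (coinv_ainv_subproof (valP a)).
Definition coinv_mul (a b : coinv) : coinv :=
  Coinv (coinv_mul_subproof (valP a) (valP b)).
Definition coinv_one : coinv := Coinv coinv_one_subproof.

Fact coinv_autf_linear : linear coinv_autf.
Proof. by move=> c x y; apply: val_inj; rewrite /= !linearP. Qed.
Fact coinv_ainvf_linear : linear coinv_ainvf.
Proof. by move=> c x y; apply: val_inj; rewrite /= !linearP. Qed.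
Fact coinv_mul_bilinear : bilinear_for *:%R *:%R coinv_mul.
Proof.
by split=> u c x y; apply: val_inj; rewrite /= ?linearP ?linearPl ?linearPr.
Qed.

HB.instance Definition _ :=
  GRing.isLinear.Build k coinv coinv *:%R coinv_autf coinv_autf_linear.
HB.instance Definition _ :=
  GRing.isLinear.Build k coinv coinv *:%R coinv_ainvf coinv_ainvf_linear.
HB.instance Definition _ :=
  bilinear_isBilinear.Build k coinv coinv coinv *:%R *:%R coinv_mul
    coinv_mul_bilinear.

Fact coinv_autK : cancel coinv_autf coinv_ainvf.
Proof. by move=> a; apply: val_inj; rewrite /= autK. Qed.
Fact coinv_ainvK : cancel coinv_ainvf coinv_autf.
Proof. by move=> a; apply: val_inj; rewrite /= ainvK. Qed.

Definition coinv_data : homAlgData k :=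
  HomAlgData (LinAut coinv_autK coinv_ainvK) coinv_mul coinv_one.

Fact coinv_is_hom_alg : is_hom_alg coinv_data.
Proof.
split=> *; apply: val_inj; rewrite /=.
- exact: hmulA B _ _ _.
- exact: hmul1 B _.
- exact: h1mul B _.
- exact: haut_mul B _ _.
- exact: haut1 B.
Qed.

Definition coinv_alg : homAlg k := HomAlg coinv_is_hom_alg.

Definition ca_lact (a : coinv_alg) (b : B) : B := val a \mul b.
Definition ca_ract (b : B) (a : coinv_alg) : B := b \mul val a.

Fact ca_lact_bilinear : bilinear_for *:%R *:%R ca_lact.
Proof. by split=> u c x y; rewrite /ca_lact ?linearP ?linearPl ?linearPr. Qed.
Fact ca_ract_bilinear : bilinear_for *:%R *:%R ca_ract.
Proof. by split=> u c x y; rewrite /ca_ract ?linearP ?linearPl ?linearPr. Qed.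

HB.instance Definition _ :=
  bilinear_isBilinear.Build k coinv_alg B B *:%R *:%R ca_lact ca_lact_bilinear.
HB.instance Definition _ :=
  bilinear_isBilinear.Build k B coinv_alg B *:%R *:%R ca_ract ca_ract_bilinear.

Definition ca_lmod : homLmod coinv_alg :=
  @HomLmod k coinv_alg B beta ca_lact
    (fun a b m => hmulA B (val a) (val b) m) (h1mul B)
    (fun a m => haut_mul B (val a) m).

Definition ca_rmod : homRmod coinv_alg :=
  @HomRmod k coinv_alg B beta ca_ract
    (fun m a b => esym (hmulA B m (val a) (val b))) (hmul1 B)
    (fun m a => haut_mul B m (val a)).

End Coinvariants.

Local Ltac leaf := by move=> ? ? ? /=;
  rewrite ?(linearP, linearPl, linearPr) ?(linearP, linearPl, linearPr)
          ?(linearP, linearPl, linearPr).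

Section Galois.
Variables (k : fieldType) (H : homHopf k) (B : homComodAlg H).
Local Notation alpha := (ha_aut H).
Local Notation beta := (ha_aut B).
Local Notation A := (coinv_alg B).

(* galois_pre is the map on B \ox B; it is balanced over A, so evaluating it   *)
(* on a representative defines the map on B \ox_A B (see galois_mapE).         *)
Definition galois_pre (t : tensor B B) : tensor B H :=
  \tsum_(a, b <- t) \tsum_(b0, b1 <- coact B b)
    ((ainv beta a \mul b0) \ox alpha b1).

Fact galois_pre_inner (a : B) :
  bilinear_for *:%R *:%R
    (fun (b0 : B) (b1 : H) => (ainv beta a \mul b0) \ox alpha b1).
Proof. by split=> ?; leaf. Qed.

Fact galois_pre_bilinear :
  bilinear_for *:%R *:%R (fun a b : B =>
    \tsum_(b0, b1 <- coact B b) ((ainv beta a \mul b0) \ox alpha b1)).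
Proof.
split=> [b|a]; first by apply: tsum_param => ? ?; leaf.
by apply: tsum_comp_linear => [|c x y]; [exact: galois_pre_inner | rewrite linearP].
Qed.

Fact galois_pre_linear : linear galois_pre.
Proof. by apply: tsum_linear; exact: galois_pre_bilinear. Qed.

Lemma galois_pre_tens a b : galois_pre (a \ox b) =
  \tsum_(b0, b1 <- coact B b) ((ainv beta a \mul b0) \ox alpha b1).
Proof. by rewrite /galois_pre tsum_tens //; exact: galois_pre_bilinear. Qed.

Lemma galois_pre_balanced (m n : B) (a : A) :
  galois_pre ((m \mul val a) \ox n)
  = galois_pre (beta m \ox (val a \mul ainv beta n)).
Proof.
rewrite !galois_pre_tens coact_mul coinvP /tens_mul.
rewrite (tsum_tens _ _ _); last first.
  by split=> u; apply: tsum_param => ? ?; leaf.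
have -> : coact B (ainv beta n) = tmap (ainv beta) (ainv alpha) (coact B n).
  by apply: (can_inj (autK (tens_aut beta alpha)));
    rewrite -coact_autE /= tens_ainvK ainvK.
rewrite /tmap (tsum_tsum (fun b0 b1 => ainv beta b0 \ox ainv alpha b1));
  last by split=> ?; leaf.
rewrite (tsum_tsum _ _); last by exact: galois_pre_inner.
apply: eq_tsum => b0 b1.
rewrite tsum_tens; last by split=> ?; leaf.
rewrite tsum_tens; last by exact: galois_pre_inner.
rewrite (h1mul H) ainvK autK; congr (_ \ox _).
by rewrite -{2}[m](ainvK beta) (hmulA B) ainvK ainv_mul.
Qed.

Definition galois_map (x : tens_over (ca_rmod B) (ca_lmod B)) : tensor B H :=
  galois_pre (qrepr x).

Lemma galois_map_proj t : galois_map (qproj _ t) = galois_pre t.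
Proof.
pose f : {linear tensor B B -> tensor B H} :=
  HB.pack galois_pre (GRing.isLinear.Build _ _ _ _ _ galois_pre_linear).
rewrite /galois_map -![galois_pre _]/(f _).
apply/eqP; rewrite -subr_eq0 -linearB; apply/eqP.
set u := _ - _; have : span (@tens_over_rel _ _ (ca_rmod B) (ca_lmod B)) u.
  by apply/qprojP; rewrite qreprK.
elim=> [|c _ w [m a n] _ IH]; first by rewrite linear0.
rewrite linearP IH addr0 linearB /= [galois_pre _]galois_pre_balanced.
by rewrite subrr scaler0.
Qed.

Fact galois_map_linear : linear galois_map.
Proof.
move=> c x y; rewrite -[x]qreprK -[y]qreprK -linearP !galois_map_proj.
exact: galois_pre_linear.
Qed.

HB.instance Definition _ :=
  GRing.isLinear.Build k (tens_over (ca_rmod B) (ca_lmod B)) (tensor B H) *:%R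
    galois_map galois_map_linear.

Lemma galois_mapE (a b : B) : galois_map (qproj _ (a \ox b)) =
  \tsum_(b0, b1 <- coact B b) ((ainv beta a \mul b0) \ox alpha b1).
Proof. by rewrite galois_map_proj galois_pre_tens. Qed.

Definition is_galois : Prop := bijective galois_map.

End Galois.

Section FreeModule.
Variables (k : fieldType) (H : homHopf k) (A : homAlg k).
Local Notation alpha := (ha_aut H).
Local Notation beta := (ha_aut A).

(* A \ox H with its left A-action and right H-coaction; these also serve as   *)
(* the module and comodule structures of the crossed product, which has the   *)
(* same underlying vector space and automorphism.                             *)
Definition free_act (a : A) (t : tensor A H) : tensor A H :=
  \tsum_(b, h <- t) ((ainv beta a \mul b) \ox alpha h).

Definition free_coact (t : tensor A H) : tensor (tensor A H) H :=
  \tsum_(a, h <- t) \tsum_(h1, h2 <- comul H h)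
    ((ainv beta a \ox h1) \ox alpha h2).

Fact free_act_inner (a : A) : bilinear_for *:%R *:%R
  (fun (b : A) (h : H) => (ainv beta a \mul b) \ox alpha h).
Proof. by split=> ?; leaf. Qed.

Fact free_act_bilinear : bilinear_for *:%R *:%R free_act.
Proof.
split=> u; first by apply: tsum_param => ? ?; leaf.
exact/tsum_linear/free_act_inner.
Qed.

HB.instance Definition _ :=
  bilinear_isBilinear.Build k A (tensor A H) (tensor A H) *:%R *:%R
    free_act free_act_bilinear.

Lemma free_actE a b h : free_act a (b \ox h) = (ainv beta a \mul b) \ox alpha h.
Proof. by rewrite /free_act tsum_tens //; exact: free_act_inner. Qed.

Fact free_coact_inner (a : A) : bilinear_for *:%R *:%R
  (fun h1 h2 : H => (ainv beta a \ox h1) \ox alpha h2).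
Proof. by split=> ?; leaf. Qed.

Fact free_coact_bilinear : bilinear_for *:%R *:%R (fun (a : A) (h : H) =>
  \tsum_(h1, h2 <- comul H h) ((ainv beta a \ox h1) \ox alpha h2)).
Proof.
split=> [h|a]; first by apply: tsum_param => ? ?; leaf.
by apply: tsum_comp_linear => [|c x y]; [exact: free_coact_inner | rewrite linearP].
Qed.

Fact free_coact_linear : linear free_coact.
Proof. by apply: tsum_linear; exact: free_coact_bilinear. Qed.

HB.instance Definition _ :=
  GRing.isLinear.Build k (tensor A H) (tensor (tensor A H) H) *:%R
    free_coact free_coact_linear.

Lemma free_coactE a h : free_coact (a \ox h) =
  \tsum_(h1, h2 <- comul H h) ((ainv beta a \ox h1) \ox alpha h2).
Proof. by rewrite /free_coact tsum_tens //; exact: free_coact_bilinear. Qed.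

Definition free_aut : linAut (tensor A H) := tens_aut beta alpha.

Fact free_actDr a t u : free_act a (t + u) = free_act a t + free_act a u.
Proof. exact: linearDr. Qed.

Fact free_act0r a : free_act a 0 = 0.
Proof. exact: linear0r. Qed.

Fact free_actA a b t :
  free_act (beta a) (free_act b t) = free_act (a \mul b) (tmap beta alpha t).
Proof.
move: t; apply: tens_ind => [|c h t IH]; first by rewrite linear0 !free_act0r.
rewrite linearD !free_actDr IH /= tmapE !free_actE autK.
by rewrite ainv_mul -(hmulA A) ainvK.
Qed.

Fact free_act1 t : free_act (ha_one A) t = tmap beta alpha t.
Proof.
move: t; apply: tens_ind => [|c h t IH]; first by rewrite linear0 free_act0r.
by rewrite linearD free_actDr IH /= tmapE free_actE ainv1 (h1mul A).
Qed.

Fact free_aut_act a t :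
  tmap beta alpha (free_act a t) = free_act (beta a) (tmap beta alpha t).
Proof.
move: t; apply: tens_ind => [|c h t IH]; first by rewrite !(linear0, free_act0r).
rewrite linearD !free_actDr linearD /= IH tmapE !free_actE tmapE.
by rewrite (haut_mul A) ainvK autK.
Qed.

Definition free_lmod : homLmod A :=
  @HomLmod k A (tensor A H) free_aut free_act free_actA free_act1 free_aut_act.

Fact free_coact_coassoc t :
  \tsum_(m0, m1 <- free_coact t) \tsum_(h1, h2 <- comul H m1)
    ((ainv free_aut m0 \ox h1) \ox h2)
  = \tsum_(m0, m1 <- free_coact t) (free_coact m0 \ox ainv alpha m1).
Proof.
have FP u : bilinear_for *:%R *:%R (fun (h1 h2 : H) =>
    (u \ox h1) \ox h2 : tensor (tensor (tensor A H) H) H).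
  by split=> ?; leaf.
have GP : bilinear_for *:%R *:%R (fun (m0 : tensor A H) (m1 : H) =>
    \tsum_(h1, h2 <- comul H m1) ((ainv free_aut m0 \ox h1) \ox h2)).
  split=> u; first by apply: tsum_param => ? ?; leaf.
  by apply: tsum_comp_linear; [exact: FP | leaf].
have KP : bilinear_for *:%R *:%R (fun (m0 : tensor A H) (m1 : H) =>
    free_coact m0 \ox ainv alpha m1).
  by split=> ?; leaf.
move: t; apply: eq_tensor => [||a h].
- by apply: tsum_comp_linear => //; exact: free_coact_linear.
- by apply: tsum_comp_linear => //; exact: free_coact_linear.
rewrite !free_coactE !tsum_tsum //.
have LaP : linear (tens (ainv beta (ainv beta a)) : H -> tensor A H) by leaf.
pose La : {linear H -> tensor A H} :=
  HB.pack (tens (ainv beta (ainv beta a)) : H -> tensor A H)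
    (GRing.isLinear.Build _ _ _ _ _ LaP).
pose L : {linear tensor (tensor H H) H -> tensor (tensor (tensor A H) H) H} :=
  tmap (tmap La alpha) alpha.
have L1E w y : L (w \ox y) = tmap La alpha w \ox alpha y by exact: tmapE.
have La1E u x : tmap La alpha (u \ox x) = La u \ox alpha x by exact: tmapE.
have := congr1 L (hcoassoc (hopf_coalg H) h); rewrite !linear_tsum => E.
transitivity (\tsum_(h1, h2 <- comul H h) L (\tsum_(h21, h22 <- comul H h2)
   ((ainv alpha h1 \ox h21) \ox h22))).
  apply: eq_tsum => h1 h2; rewrite tsum_tens // linear_tsum.
  rewrite (hcomul_aut (hopf_coalg H)) tsum_tsum; last exact: FP.
  apply: eq_tsum => x y; rewrite tsum_tens; last exact: FP.
  by rewrite L1E La1E /La /= tmapE.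
rewrite E; apply: eq_tsum => h1 h2.
by rewrite tsum_tens // free_coactE L1E autK ainvK.
Qed.

Fact free_coact_counit t :
  \tsum_(m0, m1 <- free_coact t) (counit H m1 *: m0) = ainv free_aut t.
Proof.
have GP : bilinear_for *:%R *:%R (fun (m0 : tensor A H) (m1 : H) =>
    counit H m1 *: m0).
  by split=> u c x y; rewrite ?linearP //= scalerDl scalerA.
move: t; apply: eq_tensor => [||a h].
- by apply: tsum_comp_linear => //; exact: free_coact_linear.
- exact: linearP.
have LaP : linear (tens (ainv beta a) : H -> tensor A H) by leaf.
pose La : {linear H -> tensor A H} :=
  HB.pack (tens (ainv beta a) : H -> tensor A H)
    (GRing.isLinear.Build _ _ _ _ _ LaP).
rewrite free_coactE tsum_tsum // /= tmapE -(hcounitr (hopf_coalg H)).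
rewrite -[RHS]/(La _) linear_tsum.
apply: eq_tsum => h1 h2; rewrite tsum_tens // (hcounit_aut (hopf_coalg H)).
by rewrite linearZ.
Qed.

Fact free_coact_aut t :
  free_coact (free_aut t)
  = \tsum_(m0, m1 <- free_coact t) (free_aut m0 \ox alpha m1).
Proof.
have GP : bilinear_for *:%R *:%R (fun (m0 : tensor A H) (m1 : H) =>
    free_aut m0 \ox alpha m1).
  by split=> ?; leaf.
move: t; apply: eq_tensor => [||a h].
- by move=> c x y; rewrite linearP free_coact_linear.
- by apply: tsum_comp_linear => //; exact: free_coact_linear.
rewrite /= tmapE !free_coactE (hcomul_aut (hopf_coalg H)) !tsum_tsum //.
  apply: eq_tsum => h1 h2; rewrite !tsum_tens //=; last exact: free_coact_inner.
  by rewrite tmapE autK ainvK.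
exact: free_coact_inner.
Qed.

Definition free_comod : homComod H :=
  HomComod (IsHomComod free_coact_coassoc free_coact_counit free_coact_aut).

End FreeModule.

Section CrossedProduct.
Variables (k : fieldType) (H : homHopf k) (A : homAlg k).
Local Notation alpha := (ha_aut H).
Local Notation beta := (ha_aut A).

Record is_weak_action (act : {bilinear H -> A -> A}) : Prop := IsWeakAction {
  wact_aut : forall h a, beta (act h a) = act (alpha h) (beta a);
  wact1 : forall h, act h (ha_one A) = counit H h *: ha_one A;
  wact_mul : forall h a b,
    act h (a \mul b) = \tsum_(h1, h2 <- comul H h) (act h1 a \mul act h2 b) }.

Definition conv_invertible (sigma : {bilinear H -> H -> A}) : Prop :=
  exists tau : {bilinear H -> H -> A}, forall h l,
    \tsum_(h1, h2 <- comul H h) \tsum_(l1, l2 <- comul H l)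
      (sigma h1 l1 \mul tau h2 l2) = (counit H h * counit H l) *: ha_one A
    /\
    \tsum_(h1, h2 <- comul H h) \tsum_(l1, l2 <- comul H l)
      (tau h1 l1 \mul sigma h2 l2) = (counit H h * counit H l) *: ha_one A.

Variables (act : {bilinear H -> A -> A}) (sigma : {bilinear H -> H -> A}).

Definition crossed_mul4 (a : A) (h : H) (b : A) (l : H) : tensor A H :=
  \tsum_(h1, h2 <- comul H h) \tsum_(h21, h22 <- comul H h2)
  \tsum_(l1, l2 <- comul H l)
    ((a \mul (act (ainv alpha h1) (ainv beta (ainv beta b))
            \mul sigma h21 (ainv alpha l1)))
     \ox (alpha (alpha h22) \mul alpha l2)).

Definition crossed_mul (x y : tensor A H) : tensor A H :=
  \tsum_(a, h <- x) \tsum_(b, l <- y) crossed_mul4 a h b l.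

Fact crossed_mul_bilinear : bilinear_for *:%R *:%R crossed_mul.
Proof.
apply: tsum2_bilinear => [h b l|a b l|a h l|a h b].
- by do 3![apply: tsum_param => ? ?]; leaf.
- have E2 h1 : bilinear_for *:%R *:%R (fun h21 h22 =>
      \tsum_(l1, l2 <- comul H l)
        ((a \mul (act (ainv alpha h1) (ainv beta (ainv beta b))
            \mul sigma h21 (ainv alpha l1))) \ox (alpha (alpha h22) \mul alpha l2))).
    by split=> ?; apply: tsum_param => ? ?; leaf.
  apply: tsum_comp_linear; last by leaf.
  split=> u; first by do 2![apply: tsum_param => ? ?]; leaf.
  by apply: tsum_comp_linear; [exact: E2 | leaf].
- by do 3![apply: tsum_param => ? ?]; leaf.
- do 2![apply: tsum_param => ? ?].
  by apply: tsum_comp_linear; [split=> ?; leaf | leaf].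
Qed.

HB.instance Definition _ :=
  bilinear_isBilinear.Build k (tensor A H) (tensor A H) (tensor A H) *:%R *:%R
    crossed_mul crossed_mul_bilinear.

Definition crossed_product : homAlgData k :=
  HomAlgData (tens_aut beta alpha) crossed_mul (ha_one A \ox ha_one H).

End CrossedProduct.

Arguments is_weak_action {k H A} _.
Arguments conv_invertible {k H A} _.
Arguments crossed_product {k H A} _ _.

Definition has_normal_basis (k : fieldType) (H : homHopf k) (B : homComodAlg H) :
    Prop :=
  exists f : {linear B -> tensor (coinv_alg B) H},
    [/\ bijective f,
        @is_lmod_map k (coinv_alg B) (ca_lmod B) (free_lmod H (coinv_alg B)) f
      & @is_comod_map k H (ca_comod B) (free_comod H (coinv_alg B)) f].

Definition is_crossed_iso (k : fieldType) (H : homHopf k) (B : homComodAlg H)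
    (act : {bilinear H -> coinv_alg B -> coinv_alg B})
    (sigma : {bilinear H -> H -> coinv_alg B})
    (f : {linear crossed_product act sigma -> B}) : Prop :=
  [/\ bijective f,
      is_hom_alg_map f,
      @is_lmod_map k (coinv_alg B) (free_lmod H (coinv_alg B)) (ca_lmod B) f
    & @is_comod_map k H (free_comod H (coinv_alg B)) (ca_comod B) f].

(* Main.v *)
Require Import Defs.
From HB Require Import structures.
From mathcomp Require Import all_boot all_algebra.
From mathcomp.multinomials Require Import freeg.

Set Implicit Arguments.
Unset Strict Implicit.
Unset Printing Implicit Defensive.

Import GRing.Theory.
Local Open Scope ring_scope.

(** Why the theorem is true.

    Every Hom-structure is an ordinary structure twisted by its automorphism:
    the product beta^-1(xy) is associative and unital, the coproduct
    Delta(alpha h) is coassociative and counital, the coaction rho(beta b) is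
    an ordinary coaction, and the Galois map becomes the usual
    b (x) c |-> b c_0 (x) c_1.  All Sweedler computations below are made for
    these untwisted operations ([omul], [ocomul], [ocoact]), where
    no power of an automorphism has to be tracked.

    A normal basis of B amounts to a cleaving map g : H -> B, that is, a
    colinear equivariant map for which a (x) h |-> a g(h) is a bijection from
    A (x) H onto B ([normal_basis_cleaving]).  Suppose moreover that
    g(h) g(l) = sum s(h_1, l_1) g(h_2 l_2) with s taking its values in A.  Then
    - B (x) H is isomorphic to B (x)_A B by b (x) h |-> [b (x) g(h)], so the
      Galois map can be read on B (x) H, as b (x) h |-> sum b g(h_1) (x) h_2;
    - read further on A (x) H (x) H, it is the composite of
      a (x) l (x) h |-> sum a s(l_1, h_1) (x) l_2 (x) h_2 with the shear
      a (x) l (x) h |-> sum a (x) l h_1 (x) h_2;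
    - the shear is bijective thanks to the antipode, and the first map is
      bijective exactly when s is convolution invertible ([cocycle_map_bij]).
    Hence B is Galois if and only if s is convolution invertible
    ([galois_iff_conv]).  Both implications of the theorem rest on this
    equivalence.

    From a crossed product, g(h) is the image of 1 # h and s is the given
    cocycle, up to the twist.  Conversely, for a cleaving map g let
    p : B -> A be the projection a g(h) |-> eps(h) a.  Colinearity gives
    b = sum p(b_0) g(b_1), so that h.a = p(g(h) a) and s(h, l) = p(g(h) g(l))
    satisfy the commutation rules of a crossed product, with values in A by
    construction.  Finally g can be normalised: g(1) = s(1, 1) is invertible in
    A because s is convolution invertible and 1 is grouplike
    ([cleaving_normalise]).  The map a # h |-> a g(h) is then multiplicative and
    injective, and the axioms of the crossed product are pulled back from B. *)

(** * Linear maps and sums over tensors *)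

Definition linear_of (k : fieldType) (U V : lmodType k) (f : U -> V)
    (fP : linear f) : {linear U -> V} :=
  HB.pack f (GRing.isLinear.Build _ _ _ _ f fP).

Lemma linear_comp (k : fieldType) (U V W : lmodType k) (f : {linear V -> W})
    (g : U -> V) :
  linear g -> linear (fun x => f (g x)).
Proof. by move=> gP c x y; rewrite gP linearP. Qed.

Lemma bij_linear_inv (k : fieldType) (U V : lmodType k) (f : {linear U -> V}) :
  bijective f -> exists g : {linear V -> U}, cancel f g /\ cancel g f.
Proof. by case=> g fK gK; exists (linear_of (can2_linear fK gK)). Qed.

Lemma bij_cancell (T U V : Type) (f : U -> V) (g : T -> U) :
  bijective g -> bijective (f \o g) -> bijective f.
Proof.
case=> g' gK g'K fg; apply: (eq_bij (bij_comp fg (Bijective g'K gK))) => x /=.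
by rewrite g'K.
Qed.

Lemma bij_cancelr (T U V : Type) (f : U -> V) (g : T -> U) :
  bijective f -> bijective (f \o g) -> bijective g.
Proof.
case=> f' fK f'K fg; apply: (eq_bij (bij_comp (Bijective f'K fK) fg)) => x /=.
by rewrite fK.
Qed.

Lemma quot_lift (k : fieldType) (V W : lmodType k) (S : V -> Prop)
    (L : {linear V -> W}) v :
  (forall u, S u -> L u = 0) -> L (qrepr (qproj S v)) = L v.
Proof.
move=> L0; apply/eqP; rewrite -subr_eq0 -linearB; apply/eqP.
have : Defs.span S (qrepr (qproj S v) - v) by apply/qprojP; rewrite qreprK.
by elim=> [|c u w Su _ IH]; rewrite ?linear0 // linearP IH addr0 L0 ?scaler0.
Qed.

Section TensorSums.
Variables (k : fieldType).
Implicit Types (M N P Q : lmodType k).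

Lemma tsum_exchange M N M' N' P (F : M -> N -> M' -> N' -> P) t u :
  \tsum_(a, b <- t) \tsum_(c, d <- u) F a b c d
  = \tsum_(c, d <- u) \tsum_(a, b <- t) F a b c d.
Proof.
rewrite /tsum; unlock fglift; rewrite /lift /prelift.
under eq_bigr do rewrite scaler_sumr.
rewrite exchange_big; apply: eq_bigr => i _; rewrite scaler_sumr.
by apply: eq_bigr => j _; rewrite !scalerA mulrC.
Qed.

Lemma tsumZ M N P (c : k) (F : M -> N -> P) t :
  c *: tsum F t = \tsum_(x, y <- t) (c *: F x y).
Proof. exact: (linear_tsum ( *:%R c : {linear P -> P})). Qed.

Lemma bil_tsuml M N P Q Q' (b : {bilinear P -> Q -> Q'}) (F : M -> N -> P) t y :
  b (tsum F t) y = \tsum_(m, n <- t) b (F m n) y.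
Proof. exact: (linear_tsum (applyr b y)). Qed.

Lemma bil_tsumr M N P Q Q' (b : {bilinear Q -> P -> Q'}) (F : M -> N -> P) t y :
  b y (tsum F t) = \tsum_(m, n <- t) b y (F m n).
Proof. exact: (linear_tsum (b y)). Qed.

Lemma tmap_bij M N P Q (f : {linear M -> P}) (g : {linear N -> Q}) :
  bijective f -> bijective g -> bijective (tmap f g).
Proof.
move=> /bij_linear_inv[f' [fK f'K]] /bij_linear_inv[g' [gK g'K]].
exists (tmap f' g'); apply: tens_ind => [|x y t IH].
- by rewrite !linear0.
- by rewrite !linearD /= IH !tmapE fK gK.
- by rewrite !linear0.
- by rewrite !linearD /= IH !tmapE f'K g'K.
Qed.

Lemma eq_tensor3 M N P Q (f g : tensor (tensor M N) P -> Q) :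
  linear f -> linear g ->
  (forall x y z, f ((x \ox y) \ox z) = g ((x \ox y) \ox z)) -> f =1 g.
Proof.
move=> fP gP fg; apply: eq_tensor => // t z; move: t.
by apply: eq_tensor => [c x y|c x y|x y]; rewrite ?linearPl ?fP ?gP.
Qed.

End TensorSums.

(** Sweedler sums may be manipulated only when the summand is linear in each
    variable.  The tactic proves this for summands made of nested sums, linear
    and bilinear maps: the variable occurs either in the summand
    ([tsum_param]), or in the tensor that is summed over
    ([tsum_comp_linear]). *)
Ltac lin :=
  match goal with
  | |- bilinear_for _ _ _ => split=> ?; lin
  | |- _ => intros;
     first [ by apply: linearP
     | by apply: tsum_param => ? ?; lin
     | by apply: tsum_comp_linear; lin
     | by move=> ? ? ? /=;
         rewrite ?(linearP, linearPl, linearPr) ?scalerDl ?scalerA ]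
  end.

Section Lift3.
Variables (k : fieldType) (M N P Q : lmodType k) (F : M -> N -> P -> Q).
Hypothesis Fx : forall y z, linear (fun x => F x y z).
Hypothesis Fy : forall x z, linear (fun y => F x y z).
Hypothesis Fz : forall x y, linear (F x y).

Definition lift3 (t : tensor (tensor M N) P) : Q :=
  \tsum_(u, z <- t) \tsum_(x, y <- u) F x y z.

Lemma lift3_linear : linear lift3.
Proof.
apply: tsum_linear; split=> [z|u].
  by apply: tsum_linear; split=> ?.
by apply: tsum_param => ? ?.
Qed.

Lemma lift3E x y z : lift3 ((x \ox y) \ox z) = F x y z.
Proof.
rewrite /lift3 tsum_tens ?tsum_tens //; split=> // u.
  by apply: tsum_linear; split=> ?.
by apply: tsum_param => ? ?.
Qed.

End Lift3.

Section TmapHead.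
Variables (k : fieldType) (M N P Q : lmodType k) (f : {linear M -> N}).

Definition tmap_head (x : tensor (tensor M P) Q) : tensor (tensor N P) Q :=
  tmap (tmap f (@idfun P)) (@idfun Q) x.

Fact tmap_head_linear : linear tmap_head.
Proof. by move=> c x y; rewrite /tmap_head linearP. Qed.
HB.instance Definition _ :=
  GRing.isLinear.Build k (tensor (tensor M P) Q) (tensor (tensor N P) Q) *:%R
    tmap_head tmap_head_linear.

Lemma tmap_headE a l h : tmap_head ((a \ox l) \ox h) = (f a \ox l) \ox h.
Proof. by rewrite /tmap_head tmapE /= tmapE. Qed.

End TmapHead.

(** * Untwisting *)

Reserved Notation "x \ast y" (at level 40, left associativity).

Section UntwistedProduct.
Variables (k : fieldType) (A : homAlg k).

Definition omul (x y : A) : A := ainv (ha_aut A) (x \mul y).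

Fact omul_bilinear : bilinear_for *:%R *:%R omul.
Proof.
by rewrite /omul; split=> ? c x y; rewrite ?(linearPl, linearPr) linearP.
Qed.
HB.instance Definition _ :=
  bilinear_isBilinear.Build k A A A *:%R *:%R omul omul_bilinear.

Fact omul_linear a : linear (omul a).
Proof. by move=> c x y; rewrite linearPr. Qed.
HB.instance Definition _ a :=
  GRing.isLinear.Build k A A *:%R (omul a) (omul_linear a).

End UntwistedProduct.

Notation "x \ast y" := (omul x y) : ring_scope.

Section UntwistedAlgebra.
Variables (k : fieldType) (A : homAlg k).
Local Notation beta := (ha_aut A).
Implicit Types x y z : A.

Lemma mulE x y : x \mul y = beta (x \ast y).
Proof. by rewrite /omul ainvK. Qed.

Lemma mul_ainv x y : ainv beta x \mul ainv beta y = x \ast y.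
Proof. by rewrite /omul ainv_mul. Qed.

Lemma aut_omul x y : beta (x \ast y) = beta x \ast beta y.
Proof. by rewrite {2}/omul -(haut_mul A) autK -mulE. Qed.

Lemma omulA x y z : x \ast (y \ast z) = x \ast y \ast z.
Proof.
rewrite [y \ast z]/omul [x \ast y]/omul /omul; congr (ainv _ _).
rewrite -[LHS](ainvK beta) -[RHS](ainvK beta) !ainv_mul; congr (_ _).
have := hmulA A (ainv beta (ainv beta x)) (ainv beta (ainv beta y))
                (ainv beta (ainv beta z)).
by rewrite !ainvK.
Qed.

Lemma omul1r x : x \ast ha_one A = x.
Proof. by rewrite /omul (hmul1 A) autK. Qed.

Lemma omul1l x : ha_one A \ast x = x.
Proof. by rewrite /omul (h1mul A) autK. Qed.

End UntwistedAlgebra.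

Section UntwistedHopf.
Variables (k : fieldType) (H : homHopf k).
Local Notation alpha := (ha_aut H).
Local Notation eps := (counit H).

Definition ocomul (h : H) : tensor H H := comul H (alpha h).

Fact ocomul_linear : linear ocomul.
Proof. by move=> c x y; rewrite /ocomul !linearP. Qed.
HB.instance Definition _ :=
  GRing.isLinear.Build k H (tensor H H) *:%R ocomul ocomul_linear.

Local Notation D := ocomul.

Lemma comulE h : comul H h = tmap (ainv alpha) (ainv alpha) (D h).
Proof.
apply: (can_inj (autK (tens_aut alpha alpha))); rewrite /= tens_ainvK.
by rewrite /D (hcomul_aut (hopf_coalg H)).
Qed.

Lemma sum_comul (V : lmodType k) (F : H -> H -> V) h :
  bilinear_for *:%R *:%R F ->
  tsum F (comul H h) = \tsum_(x, y <- D h) F (ainv alpha x) (ainv alpha y).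
Proof.
move=> FP; rewrite comulE /tmap tsum_tsum //.
by apply: eq_tsum => x y; rewrite tsum_tens.
Qed.

Lemma sum_ocomul_aut (V : lmodType k) (F : H -> H -> V) h :
  bilinear_for *:%R *:%R F ->
  tsum F (D (alpha h)) = \tsum_(x, y <- D h) F (alpha x) (alpha y).
Proof.
move=> FP; rewrite {1}/D (hcomul_aut (hopf_coalg H)) tsum_tsum //.
by apply: eq_tsum => x y; rewrite tsum_tens.
Qed.

Lemma sum_ocomul_ainv (V : lmodType k) (F : H -> H -> V) h :
  bilinear_for *:%R *:%R F ->
  tsum F (D (ainv alpha h))
  = \tsum_(x, y <- D h) F (ainv alpha x) (ainv alpha y).
Proof. by move=> FP; rewrite {1}/D ainvK sum_comul. Qed.

Lemma counit_ainv h : eps (ainv alpha h) = eps h.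
Proof. by rewrite -(hcounit_aut (hopf_coalg H)) ainvK. Qed.

Lemma ocounitr (V : lmodType k) (F : H -> V) h : linear F ->
  \tsum_(x, y <- D h) (eps y *: F x) = F h.
Proof.
move=> FP; rewrite -{2}[h](autK alpha) -(hcounitr (hopf_coalg H)).
rewrite -[F _]/(linear_of FP _) linear_tsum.
by apply: eq_tsum => x y; rewrite linearZ.
Qed.

Lemma ocounitl (V : lmodType k) (F : H -> V) h : linear F ->
  \tsum_(x, y <- D h) (eps x *: F y) = F h.
Proof.
move=> FP; rewrite -{2}[h](autK alpha) -(hcounitl (hopf_coalg H)).
rewrite -[F _]/(linear_of FP _) linear_tsum.
by apply: eq_tsum => x y; rewrite linearZ.
Qed.

(** Hom-coassociativity at alpha(h), transported by alpha on the three tensor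
    factors, is ordinary coassociativity: on the left alpha cancels the alpha^-1
    of the first factor and turns the coproduct of the second one into its
    untwisted form, on the right it does the same with the factors exchanged. *)
Lemma ocoassoc (V : lmodType k) (F : H -> H -> H -> V) h :
  (forall y z, linear (fun x => F x y z)) ->
  (forall x z, linear (fun y => F x y z)) ->
  (forall x y, linear (F x y)) ->
  \tsum_(x, y <- D h) \tsum_(y1, y2 <- D y) F x y1 y2
  = \tsum_(x, y <- D h) \tsum_(x1, x2 <- D x) F x1 x2 y.
Proof.
move=> Fx Fy Fz; pose G (x y z : H) := F (alpha x) (alpha y) (alpha z).
have Gx y z : linear (fun x => G x y z) by move=> c ? ?; rewrite /G linearP Fx.
have Gy x z : linear (fun y => G x y z) by move=> c ? ?; rewrite /G linearP Fy.
have Gz x y : linear (fun z => G x y z) by move=> c ? ?; rewrite /G linearP Fz.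
pose K := linear_of (lift3_linear Gx Gy Gz).
have KE x y z : K ((x \ox y) \ox z) = G x y z by exact: lift3E.
have := congr1 K (hcoassoc (hopf_coalg H) (alpha h)); rewrite !linear_tsum => E.
transitivity (\tsum_(x, y <- D h)
    K (\tsum_(y1, y2 <- comul H y) ((ainv alpha x \ox y1) \ox y2))).
  apply: eq_tsum => x y; rewrite linear_tsum.
  rewrite {1}/D (hcomul_aut (hopf_coalg H)) tsum_tsum; last by split=> ?.
  by apply: eq_tsum => y1 y2; rewrite tsum_tens; [rewrite KE /G ainvK | split=> ?].
rewrite E; apply: eq_tsum => x y.
rewrite {1}/D (hcomul_aut (hopf_coalg H)) tsum_tsum; last by split=> ?.
transitivity (K (\tsum_(x1, x2 <- comul H x) ((x1 \ox x2) \ox ainv alpha y))).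
  congr (K _); move: (comul H x); apply: eq_tensor => [||x1 x2].
  - by lin.
  - by apply: tsum_linear; lin.
  - by rewrite tsum_tens //; lin.
rewrite linear_tsum; apply: eq_tsum => x1 x2.
by rewrite tsum_tens; [rewrite KE /G ainvK | split=> ?].
Qed.

Lemma ocomul1 : D (ha_one H) = ha_one H \ox ha_one H.
Proof. by rewrite /ocomul (haut1 H) comul1. Qed.

Lemma oantipodel h :
  \tsum_(x, y <- D h) (antipode H x \ast y) = eps h *: ha_one H.
Proof.
rewrite /omul -linear_tsum antipodel linearZ /= ainv1.
by rewrite (hcounit_aut (hopf_coalg H)).
Qed.

Lemma oantipoder h :
  \tsum_(x, y <- D h) (x \ast antipode H y) = eps h *: ha_one H.
Proof.
rewrite /omul -linear_tsum antipoder linearZ /= ainv1.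
by rewrite (hcounit_aut (hopf_coalg H)).
Qed.

End UntwistedHopf.

Section UntwistedComodule.
Variables (k : fieldType) (H : homHopf k) (B : homComodAlg H).
Local Notation alpha := (ha_aut H).
Local Notation beta := (ha_aut B).
Local Notation A := (coinv_alg B).

Definition ocoact (b : B) : tensor B H := coact B (beta b).

Fact ocoact_linear : linear ocoact.
Proof. by move=> c x y; rewrite /ocoact !linearP. Qed.
HB.instance Definition _ :=
  GRing.isLinear.Build k B (tensor B H) *:%R ocoact ocoact_linear.

Local Notation R := ocoact.

Lemma coactE b : coact B b = tmap (ainv beta) (ainv alpha) (R b).
Proof.
apply: (can_inj (autK (tens_aut beta alpha))); rewrite /= tens_ainvK.
by rewrite /R coact_autE.
Qed.

Lemma sum_coact (V : lmodType k) (F : B -> H -> V) b :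
  bilinear_for *:%R *:%R F ->
  tsum F (coact B b) = \tsum_(x, y <- R b) F (ainv beta x) (ainv alpha y).
Proof.
move=> FP; rewrite coactE /tmap tsum_tsum //.
by apply: eq_tsum => x y; rewrite tsum_tens.
Qed.

Lemma ocoact_mul x y : R (x \ast y) =
  \tsum_(x0, x1 <- R x) \tsum_(y0, y1 <- R y) ((x0 \ast y0) \ox (x1 \ast y1)).
Proof.
rewrite {1}/R -mulE coact_mul /tens_mul.
under eq_tsum => a b do (rewrite sum_coact; last by lin).
rewrite sum_coact; last by lin.
by apply: eq_tsum => a b; apply: eq_tsum => c d; rewrite !mul_ainv.
Qed.

Definition inc (a : A) : B := val a.

Fact inc_linear : linear inc.
Proof. by []. Qed.
HB.instance Definition _ := GRing.isLinear.Build k A B *:%R inc inc_linear.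

Lemma inc_omul a b : inc (a \ast b) = inc a \ast inc b.
Proof. by []. Qed.

Lemma inc1 : inc (ha_one A) = ha_one B.
Proof. by []. Qed.

Lemma inc_inj : injective inc.
Proof. exact: val_inj. Qed.

Lemma inc_aut a : inc (ha_aut A a) = beta (inc a).
Proof. by []. Qed.

Lemma ocoact_inc a : R (inc a) = inc a \ox ha_one H.
Proof. by rewrite /R -inc_aut /inc coinvP /= autK. Qed.

Lemma ocoact_incl a b :
  R (inc a \ast b) = \tsum_(b0, b1 <- R b) ((inc a \ast b0) \ox b1).
Proof.
rewrite ocoact_mul ocoact_inc tsum_tens; last by lin.
by apply: eq_tsum => b0 b1; rewrite omul1l.
Qed.

Lemma coinv_inc b : R b = b \ox ha_one H -> exists a, b = inc a.
Proof.
move=> Rb; suff bP : b \in @coinv_pred k H B by exists (Coinv bP).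
rewrite -[b](autK beta); apply: coinv_ainv_subproof.
by rewrite inE -/(ocoact b) Rb autK.
Qed.

Lemma galoisE (a b : B) :
  galois_map (qproj _ (a \ox b)) = \tsum_(b0, b1 <- R b) ((a \ast b0) \ox b1).
Proof.
rewrite galois_mapE sum_coact; last by lin.
by apply: eq_tsum => b0 b1; rewrite mul_ainv ainvK.
Qed.

End UntwistedComodule.

(** * Convolution invertibility as a bijectivity *)

Section Convolution.
Variables (k : fieldType) (H : homHopf k) (A : homAlg k).
Local Notation D := (@ocomul k H).
Local Notation eps := (counit H).
Local Notation AHH := (tensor (tensor A H) H).
Implicit Types s t : {bilinear H -> H -> A}.

Definition conv s t (l h : H) : A :=
  \tsum_(l1, l2 <- D l) \tsum_(h1, h2 <- D h) (s l1 h1 \ast t l2 h2).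

Definition conv_inverse s t : Prop :=
  forall l h, conv s t l h = (eps l * eps h) *: ha_one A /\
              conv t s l h = (eps l * eps h) *: ha_one A.

Definition cocycle_map s (x : AHH) : AHH :=
  lift3 (fun a l h => \tsum_(l1, l2 <- D l) \tsum_(h1, h2 <- D h)
    (((a \ast s l1 h1) \ox l2) \ox h2)) x.

Section CocycleMap.
Variable s : {bilinear H -> H -> A}.

Let linear_a l h : linear (fun a : A =>
  \tsum_(l1, l2 <- D l) \tsum_(h1, h2 <- D h) (((a \ast s l1 h1) \ox l2) \ox h2)).
Proof. lin. Qed.
Let linear_l a h : linear (fun l =>
  \tsum_(l1, l2 <- D l) \tsum_(h1, h2 <- D h) (((a \ast s l1 h1) \ox l2) \ox h2)).
Proof. lin. Qed.
Let linear_h a l : linear (fun h =>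
  \tsum_(l1, l2 <- D l) \tsum_(h1, h2 <- D h) (((a \ast s l1 h1) \ox l2) \ox h2)).
Proof. lin. Qed.

Fact cocycle_map_linear : linear (cocycle_map s).
Proof. exact: lift3_linear. Qed.
HB.instance Definition _ :=
  GRing.isLinear.Build k AHH AHH *:%R (cocycle_map s) cocycle_map_linear.

Lemma cocycle_mapE a l h : cocycle_map s ((a \ox l) \ox h) =
  \tsum_(l1, l2 <- D l) \tsum_(h1, h2 <- D h) (((a \ast s l1 h1) \ox l2) \ox h2).
Proof. by rewrite /cocycle_map lift3E. Qed.

End CocycleMap.

Lemma cocycle_map_comp s t a l h :
  cocycle_map s (cocycle_map t ((a \ox l) \ox h)) =
  \tsum_(l1, l2 <- D l) \tsum_(h1, h2 <- D h)
    (((a \ast conv t s l1 h1) \ox l2) \ox h2).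
Proof.
rewrite cocycle_mapE linear_tsum /=.
under eq_tsum => l1 l2.
  rewrite linear_tsum /=.
  under eq_tsum => h1 h2 do rewrite cocycle_mapE.
  rewrite tsum_exchange.
  under eq_tsum => l21 l22.
    rewrite ocoassoc; [|lin|lin|lin]. over.
  over.
rewrite ocoassoc; [|lin|lin|lin].
apply: eq_tsum => l1 l2; rewrite tsum_exchange; apply: eq_tsum => h1 h2.
rewrite /conv bil_tsumr 2!bil_tsuml; apply: eq_tsum => l11 l12.
rewrite bil_tsumr 2!bil_tsuml; apply: eq_tsum => h11 h12.
by rewrite /= omulA.
Qed.

Lemma cocycle_map_cancel s t :
  (forall l h, conv t s l h = (eps l * eps h) *: ha_one A) ->
  cancel (cocycle_map t) (cocycle_map s).
Proof.
move=> ts1; apply: eq_tensor3 => [||a l h]; [exact/linear_comp/linearP|lin|].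
rewrite cocycle_map_comp.
transitivity (\tsum_(l1, l2 <- D l) (eps l1 *: ((a \ox l2) \ox h))).
  apply: eq_tsum => l1 l2.
  transitivity (\tsum_(h1, h2 <- D h)
                  (eps h1 *: (eps l1 *: ((a \ox l2) \ox h2)))).
    apply: eq_tsum => h1 h2.
    by rewrite ts1 linearZr_LR /= omul1r !linearZl_LR /= scalerA mulrC.
  by rewrite (ocounitl (F := fun h => eps l1 *: ((a \ox l2) \ox h))); last by lin.
by rewrite (ocounitl (F := fun l => (a \ox l) \ox h)); last by lin.
Qed.

Definition counit_pair (x : AHH) : A :=
  lift3 (fun a l h => (eps l * eps h) *: a) x.

Fact counit_pair_linear_a l h : linear (fun a : A => (eps l * eps h) *: a).
Proof. by move=> c x y; rewrite scalerDr !scalerA mulrC. Qed.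
Fact counit_pair_linear_l (a : A) h : linear (fun l => (eps l * eps h) *: a).
Proof. by move=> c x y; rewrite linearP mulrDl scalerDl scalerA mulrA. Qed.
Fact counit_pair_linear_h (a : A) l : linear (fun h => (eps l * eps h) *: a).
Proof. by move=> c x y; rewrite linearP mulrDr scalerDl scalerA mulrCA. Qed.
Fact counit_pair_linear : linear counit_pair.
Proof.
exact: (lift3_linear counit_pair_linear_a counit_pair_linear_l
                     counit_pair_linear_h).
Qed.
HB.instance Definition _ :=
  GRing.isLinear.Build k AHH A *:%R counit_pair counit_pair_linear.

Lemma counit_pairE a l h :
  counit_pair ((a \ox l) \ox h) = (eps l * eps h) *: a.
Proof.
exact: (lift3E counit_pair_linear_a counit_pair_linear_l counit_pair_linear_h).
Qed.

(** The coaction of the coalgebra H (x) H on the cofree comodule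
    A (x) (H (x) H).  The two coalgebra factors are kept as separate outer
    factors, so that applying [tmap_head counit_pair] gives back an element of
    (A (x) H) (x) H. *)
Definition coact_pair (x : AHH) : tensor (tensor AHH H) H :=
  lift3 (fun a l h => \tsum_(l1, l2 <- D l) \tsum_(h1, h2 <- D h)
    ((((a \ox l1) \ox h1) \ox l2) \ox h2)) x.

Fact coact_pair_linear_a l h : linear (fun a : A =>
  \tsum_(l1, l2 <- D l) \tsum_(h1, h2 <- D h)
    ((((a \ox l1) \ox h1) \ox l2) \ox h2)).
Proof. lin. Qed.
Fact coact_pair_linear_l (a : A) h : linear (fun l =>
  \tsum_(l1, l2 <- D l) \tsum_(h1, h2 <- D h)
    ((((a \ox l1) \ox h1) \ox l2) \ox h2)).
Proof. lin. Qed.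
Fact coact_pair_linear_h (a : A) l : linear (fun h =>
  \tsum_(l1, l2 <- D l) \tsum_(h1, h2 <- D h)
    ((((a \ox l1) \ox h1) \ox l2) \ox h2)).
Proof. lin. Qed.
Fact coact_pair_linear : linear coact_pair.
Proof.
exact: (lift3_linear coact_pair_linear_a coact_pair_linear_l
                     coact_pair_linear_h).
Qed.
HB.instance Definition _ :=
  GRing.isLinear.Build k AHH (tensor (tensor AHH H) H) *:%R
    coact_pair coact_pair_linear.

Lemma coact_pairE a l h : coact_pair ((a \ox l) \ox h) =
  \tsum_(l1, l2 <- D l) \tsum_(h1, h2 <- D h)
    ((((a \ox l1) \ox h1) \ox l2) \ox h2).
Proof.
exact: (lift3E coact_pair_linear_a coact_pair_linear_l coact_pair_linear_h).
Qed.

Lemma counit_coact_pair x : tmap_head counit_pair (coact_pair x) = x.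
Proof.
move: x; apply: eq_tensor3 => [||a l h]; [exact/linear_comp/linearP|lin|].
rewrite coact_pairE linear_tsum.
rewrite -[RHS](ocounitl (F := fun l => (a \ox l) \ox h)); last by lin.
apply: eq_tsum => l1 l2 /=; rewrite linear_tsum.
rewrite -[RHS](ocounitl (F := fun h => eps l1 *: ((a \ox l2) \ox h))); last by lin.
apply: eq_tsum => h1 h2.
by rewrite /= tmap_headE /= counit_pairE !linearZl_LR /= scalerA mulrC.
Qed.

Lemma coact_pair_cocycle_map s x :
  coact_pair (cocycle_map s x) = tmap_head (cocycle_map s) (coact_pair x).
Proof.
move: x; apply: eq_tensor3 => [||a l h]; [exact/linear_comp/linearP..|].
rewrite cocycle_mapE coact_pairE [LHS]linear_tsum [RHS]linear_tsum /=.
under eq_tsum => l1 l2.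
  rewrite linear_tsum /=.
  under eq_tsum => h1 h2 do rewrite coact_pairE.
  rewrite tsum_exchange.
  under eq_tsum => l21 l22.
    rewrite ocoassoc; [|lin|lin|lin]. over.
  over.
rewrite ocoassoc; [|lin|lin|lin].
apply: eq_tsum => l1 l2; rewrite tsum_exchange [RHS]linear_tsum.
apply: eq_tsum => h1 h2; rewrite /= tmap_headE /= cocycle_mapE 2!bil_tsuml.
by apply: eq_tsum => l11 l12; rewrite 2!bil_tsuml.
Qed.

Lemma cocycle_map_act s a x :
  cocycle_map s (tmap_head (omul a) x) = tmap_head (omul a) (cocycle_map s x).
Proof.
move: x; apply: eq_tensor3 => [||b l h]; [exact/linear_comp/linearP..|].
rewrite tmap_headE !cocycle_mapE [RHS]linear_tsum; apply: eq_tsum => l1 l2.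
by rewrite [RHS]linear_tsum; apply: eq_tsum => h1 h2; rewrite /= tmap_headE /= omulA.
Qed.

Lemma counit_cocycle_map s a l h :
  counit_pair (cocycle_map s ((a \ox l) \ox h)) = a \ast s l h.
Proof.
rewrite cocycle_mapE linear_tsum.
transitivity (\tsum_(l1, l2 <- D l) (eps l2 *: (a \ast s l1 h))).
  apply: eq_tsum => l1 l2; rewrite linear_tsum.
  rewrite -(ocounitr (F := fun h => eps l2 *: (a \ast s l1 h))); last by lin.
  by apply: eq_tsum => h1 h2; rewrite /= counit_pairE scalerA mulrC.
by rewrite (ocounitr (F := fun l => a \ast s l h)); last by lin.
Qed.

Lemma counit_cocycle_map_comp s t l h :
  counit_pair (cocycle_map s (cocycle_map t ((ha_one A \ox l) \ox h)))
  = conv t s l h.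
Proof.
rewrite [cocycle_map t _]cocycle_mapE [cocycle_map s _]linear_tsum /conv.
rewrite [LHS]linear_tsum; apply: eq_tsum => l1 l2 /=.
rewrite [cocycle_map s _]linear_tsum [LHS]linear_tsum.
by apply: eq_tsum => h1 h2 /=; rewrite counit_cocycle_map omul1l.
Qed.

(** The endomorphisms of A (x) (H (x) H) that are A-linear and colinear over
    the coalgebra H (x) H are exactly the [cocycle_map]s, s being recovered by
    applying the counits; composition of maps is convolution.  An inverse of
    such a map is again A-linear and colinear, hence comes from a convolution
    inverse. *)
Lemma cocycle_map_bij s :
  bijective (cocycle_map s) <-> exists t, conv_inverse s t.
Proof.
split=> [/bij_linear_inv[G [sG Gs]] | [t st]]; last first.
  by exists (cocycle_map t); apply: cocycle_map_cancel => l h; have [] := st l h.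
pose t0 l h := counit_pair (G ((ha_one A \ox l) \ox h)).
have t0P : bilinear_for *:%R *:%R t0 by rewrite /t0; lin.
pose t : {bilinear H -> H -> A} :=
  HB.pack t0 (bilinear_isBilinear.Build k H H A *:%R *:%R t0 t0P).
have tE l h : t l h = counit_pair (G ((ha_one A \ox l) \ox h)) by [].
clearbody t.
have G_coact x : coact_pair (G x) = tmap_head G (coact_pair x).
  rewrite -{2}[x]Gs coact_pair_cocycle_map; move: (coact_pair (G x)).
  apply: eq_tensor3 => [||y l h]; [lin|exact/linear_comp/linearP|].
  by rewrite !tmap_headE sG.
have G_act a x : G (tmap_head (omul a) x) = tmap_head (omul a) (G x).
  by rewrite -{1}[x]Gs -cocycle_map_act sG.
have Gt : G =1 cocycle_map t.
  apply: eq_tensor3 => [||a l h]; [lin|lin|].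
  have -> : ((a \ox l) \ox h : AHH)
            = tmap_head (omul a) ((ha_one A \ox l) \ox h).
    by rewrite tmap_headE /= omul1r.
  rewrite G_act cocycle_map_act; congr (tmap_head _ _).
  rewrite -[LHS]counit_coact_pair G_coact coact_pairE cocycle_mapE.
  rewrite [tmap_head G _]linear_tsum [LHS]linear_tsum.
  apply: eq_tsum => l1 l2 /=.
  rewrite [tmap_head G _]linear_tsum [LHS]linear_tsum.
  by apply: eq_tsum => h1 h2 /=; rewrite !tmap_headE /= tE omul1l.
exists t => l h; split.
  by rewrite -counit_cocycle_map_comp -Gt sG counit_pairE.
by rewrite -counit_cocycle_map_comp -Gt Gs counit_pairE.
Qed.

End Convolution.

Section Shear.
Variables (k : fieldType) (H : homHopf k) (M : lmodType k).
Local Notation D := (@ocomul k H).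
Local Notation eps := (counit H).
Local Notation MHH := (tensor (tensor M H) H).

Definition shear (f : H -> H) (x : MHH) : MHH :=
  lift3 (fun a l h => \tsum_(h1, h2 <- D h) ((a \ox (l \ast f h1)) \ox h2)) x.

Section ShearLinear.
Variable f : {linear H -> H}.

Fact shear_linear_m l h : linear (fun a : M =>
  \tsum_(h1, h2 <- D h) ((a \ox (l \ast f h1)) \ox h2)).
Proof. lin. Qed.
Fact shear_linear_l (a : M) h : linear (fun l =>
  \tsum_(h1, h2 <- D h) ((a \ox (l \ast f h1)) \ox h2)).
Proof. lin. Qed.
Fact shear_linear_h (a : M) l : linear (fun h =>
  \tsum_(h1, h2 <- D h) ((a \ox (l \ast f h1)) \ox h2)).
Proof. lin. Qed.
Fact shear_linear : linear (shear f).
Proof. exact: (lift3_linear shear_linear_m shear_linear_l shear_linear_h). Qed.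
HB.instance Definition _ :=
  GRing.isLinear.Build k MHH MHH *:%R (shear f) shear_linear.

Lemma shearE a l h : shear f ((a \ox l) \ox h) =
  \tsum_(h1, h2 <- D h) ((a \ox (l \ast f h1)) \ox h2).
Proof. exact: (lift3E shear_linear_m shear_linear_l shear_linear_h). Qed.

End ShearLinear.

Lemma shear_cancel (f g : {linear H -> H}) :
  (forall h, \tsum_(x, y <- D h) (f x \ast g y) = eps h *: ha_one H) ->
  cancel (shear f) (shear g).
Proof.
move=> fg1; apply: eq_tensor3 => [||a l h]; [exact/linear_comp/linearP|lin|].
rewrite shearE linear_tsum /=.
under eq_tsum => h1 h2 do rewrite shearE.
rewrite ocoassoc; [|lin..].
rewrite -[RHS](ocounitl (F := fun h => (a \ox l) \ox h)); last by lin.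
apply: eq_tsum => h1 h2.
have -> : eps h1 *: ((a \ox l) \ox h2)
          = (a \ox (l \ast (eps h1 *: ha_one H))) \ox h2.
  by rewrite linearZr_LR /= omul1r linearZr_LR linearZl_LR.
rewrite -fg1 bil_tsumr bil_tsumr bil_tsuml; apply: eq_tsum => x y.
by rewrite /= omulA.
Qed.

Lemma shear_bij : bijective (shear (@idfun H)).
Proof.
exists (shear (antipode H)); apply: shear_cancel => h.
  exact: oantipoder.
exact: oantipodel.
Qed.

End Shear.

(** * The Galois map read through a section *)

Section GaloisSection.
Variables (k : fieldType) (H : homHopf k) (B : homComodAlg H).
Local Notation A := (coinv_alg B).
Local Notation D := (@ocomul k H).
Local Notation R := (@ocoact k H B).
Local Notation BB := (tens_over (ca_rmod B) (ca_lmod B)).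
Local Notation BB_rel := (@tens_over_rel k A (ca_rmod B) (ca_lmod B)).

Lemma tens_over_balanced (b c : B) (a : A) :
  qproj BB_rel ((b \ast inc a) \ox c) = qproj BB_rel (b \ox (inc a \ast c)).
Proof.
apply/qprojP/mem_span.
have := TensOverRel (M := ca_rmod B) (N := ca_lmod B)
          (ainv (ha_aut B) b) (ainv (ha_aut A) a) c.
rewrite /= /ca_ract /ca_lact ainvK.
by rewrite -[val _]/(ainv (ha_aut B) (inc a)) !mul_ainv.
Qed.

Variable g : {linear H -> B}.

Definition basis_map (t : tensor A H) : B := \tsum_(a, h <- t) (inc a \ast g h).

Fact basis_map_linear : linear basis_map.
Proof. by apply: tsum_linear; lin. Qed.
HB.instance Definition _ :=
  GRing.isLinear.Build k (tensor A H) B *:%R basis_map basis_map_linear.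

Lemma basis_mapE a h : basis_map (a \ox h) = inc a \ast g h.
Proof. by rewrite /basis_map tsum_tens; last by lin. Qed.

Lemma basis_map_act a t :
  basis_map (tmap (omul a) (@idfun H) t) = inc a \ast basis_map t.
Proof.
move: t; apply: eq_tensor => [||b h]; [exact/linear_comp/linearP|lin|].
by rewrite tmapE /= !basis_mapE inc_omul omulA.
Qed.

Definition tens_section (t : tensor B H) : BB := qproj _ (tmap (@idfun B) g t).

Fact tens_section_linear : linear tens_section.
Proof. by move=> c x y; rewrite /tens_section !linearP. Qed.
HB.instance Definition _ :=
  GRing.isLinear.Build k (tensor B H) BB *:%R tens_section tens_section_linear.

(** The inverse sends the class of b (x) a g(h) to b a (x) h: tensoring over A
    with the free module with basis g(H) amounts to tensoring with H. *)
Lemma tens_section_bij : bijective basis_map -> bijective tens_section.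
Proof.
move=> /bij_linear_inv[f [fK Kf]].
have f_act a b : f (inc a \ast b) = tmap (omul a) (@idfun H) (f b).
  by rewrite -{1}[b]Kf -basis_map_act fK.
have f_sec h : f (g h) = ha_one A \ox h.
  by rewrite -[g h]omul1l -inc1 -basis_mapE fK.
pose P t := \tsum_(b, c <- t) \tsum_(a, h <- f c) ((b \ast inc a) \ox h).
have Pbil : bilinear_for *:%R *:%R
    (fun b c : B => \tsum_(a, h <- f c) ((b \ast inc a) \ox h)) by lin.
pose L := linear_of (tsum_linear Pbil).
have LE b c : L (b \ox c) = \tsum_(a, h <- f c) ((b \ast inc a) \ox h).
  by rewrite /L /= tsum_tens.
clearbody L.
have L0 u : BB_rel u -> L u = 0.
  case=> m a n; rewrite linearB /= /ca_ract /ca_lact !LE.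
  apply/eqP; rewrite subr_eq0; apply/eqP.
  rewrite -!/(inc _) !mulE !aut_omul ainvK -inc_aut f_act.
  rewrite /tmap tsum_tsum; last by lin.
  apply: eq_tsum => a' h /=.
  by rewrite tsum_tens /= ?inc_omul ?omulA //; lin.
exists (fun x => L (qrepr x)).
  move=> t; rewrite /tens_section quot_lift //; move: t.
  apply: eq_tensor => [||b h]; [exact/linear_comp/linearP|lin|].
  rewrite tmapE LE f_sec tsum_tens; last by lin.
  by rewrite /= inc1 omul1r.
move=> x; rewrite -[x in RHS]qreprK; move: (qrepr x).
apply: eq_tensor => [||b c]; [exact/linear_comp/linearP|lin|].
rewrite LE -[c in RHS]Kf linear_tsum /= /basis_map bil_tsumr linear_tsum.
by apply: eq_tsum => a h; rewrite /= /tens_section tmapE /= tens_over_balanced.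
Qed.

Definition section_galois (t : tensor B H) : tensor B H :=
  \tsum_(b, h <- t) \tsum_(h1, h2 <- D h) ((b \ast g h1) \ox h2).

Fact section_galois_linear : linear section_galois.
Proof. by apply: tsum_linear; lin. Qed.
HB.instance Definition _ :=
  GRing.isLinear.Build k (tensor B H) (tensor B H) *:%R
    section_galois section_galois_linear.

Lemma section_galoisE b h :
  section_galois (b \ox h) = \tsum_(h1, h2 <- D h) ((b \ast g h1) \ox h2).
Proof. by rewrite /section_galois tsum_tens; last by lin. Qed.

Hypothesis g_coact : forall h, R (g h) = \tsum_(h1, h2 <- D h) (g h1 \ox h2).

Lemma galois_tens_section : @galois_map k H B \o tens_section =1 section_galois.
Proof.
apply: eq_tensor => [||b h]; [|lin|].
  exact/(@linear_comp _ _ _ _ (@galois_map k H B) tens_section)/linearP.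
rewrite /= /tens_section tmapE galoisE g_coact tsum_tsum; last by lin.
rewrite section_galoisE; apply: eq_tsum => h1 h2.
by rewrite tsum_tens; last by lin.
Qed.

Variable s : {bilinear H -> H -> A}.
Hypothesis g_mul : forall h l, g h \ast g l =
  \tsum_(h1, h2 <- D h) \tsum_(l1, l2 <- D l) (inc (s h1 l1) \ast g (h2 \ast l2)).

Lemma section_galois_factor x :
  section_galois (tmap basis_map (@idfun H) x) =
  tmap basis_map (@idfun H) (shear (@idfun H) (cocycle_map s x)).
Proof.
move: x; apply: eq_tensor3 => [||a l h];
 [exact/linear_comp/linearP|exact/linear_comp/linear_comp/linearP|].
rewrite tmapE /= basis_mapE section_galoisE cocycle_mapE.
transitivity (\tsum_(h1, h2 <- D h) \tsum_(l1, l2 <- D l)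
   \tsum_(h11, h12 <- D h1)
     ((inc (a \ast s l1 h11) \ast g (l2 \ast h12)) \ox h2)).
  apply: eq_tsum => h1 h2; rewrite -omulA g_mul bil_tsumr bil_tsuml.
  apply: eq_tsum => l1 l2; rewrite bil_tsumr bil_tsuml.
  by apply: eq_tsum => h11 h12; rewrite /= inc_omul omulA.
rewrite tsum_exchange [shear _ _]linear_tsum [RHS]linear_tsum.
apply: eq_tsum => l1 l2 /=.
rewrite -ocoassoc; [|lin..].
rewrite [shear _ _]linear_tsum [RHS]linear_tsum.
apply: eq_tsum => h1 h2 /=.
rewrite shearE [RHS]linear_tsum; apply: eq_tsum => x y.
by rewrite /= tmapE /= basis_mapE.
Qed.

(** The Galois map differs from [cocycle_map s] by composition with the
    bijections [tens_section], [shear idfun] and [basis_map] (x) id. *)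
Lemma galois_iff_conv :
  bijective basis_map -> is_galois B <-> exists t, conv_inverse s t.
Proof.
move=> gB; rewrite -cocycle_map_bij /is_galois.
have tB := tens_section_bij gB.
have nB : bijective (tmap basis_map (@idfun H)).
  by apply: tmap_bij => //; exists id.
have sB := @shear_bij k H A.
split=> [galB|cB].
  apply: (bij_cancelr sB); apply: (bij_cancelr nB).
  apply: (eq_bij (bij_comp (eq_bij (bij_comp galB tB) galois_tens_section) nB)).
  by move=> x /=; rewrite section_galois_factor.
apply: (bij_cancell tB); apply: (@eq_bij _ _ section_galois); last first.
  by move=> x; rewrite galois_tens_section.
apply: (bij_cancell nB); apply: (eq_bij (bij_comp nB (bij_comp sB cB))).
by move=> x /=; rewrite section_galois_factor.
Qed.

End GaloisSection.

(** * Normal bases and cleaving maps *)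

Section InverseMorphisms.
Variables (k : fieldType) (A : homAlg k) (H : homHopf k).

Lemma lmod_map_inv (M N : homLmod A) (f : {linear M -> N}) (g : {linear N -> M}) :
  cancel f g -> cancel g f -> is_lmod_map f -> is_lmod_map g.
Proof.
move=> fg gf [f_aut f_act]; split=> [m|a m]; apply: (can_inj fg).
  by rewrite f_aut !gf.
by rewrite f_act !gf.
Qed.

Lemma comod_map_inv (M N : homComod H) (f : {linear M -> N})
    (g : {linear N -> M}) :
  cancel f g -> cancel g f -> is_comod_map f -> is_comod_map g.
Proof.
move=> fg gf [f_aut f_coact].
split=> [m|m]; first by apply: (can_inj fg); rewrite f_aut !gf.
rewrite -{2}[m]gf f_coact tsum_tsum; last by lin.
rewrite -[LHS]/(cm_coact M (g m)); move: (cm_coact M (g m)).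
apply: eq_tensor => [c x y //||x y].
  by apply: tsum_linear; split=> ?; [apply: tsum_comp_linear|]; lin.
rewrite tsum_tens; last by split=> ?; [apply: tsum_comp_linear|]; lin.
by rewrite tsum_tens ?fg; last by lin.
Qed.

End InverseMorphisms.

Section Cleaving.
Variables (k : fieldType) (H : homHopf k) (B : homComodAlg H).
Local Notation alpha := (ha_aut H).
Local Notation beta := (ha_aut B).
Local Notation A := (coinv_alg B).
Local Notation D := (@ocomul k H).
Local Notation R := (@ocoact k H B).
Local Notation eps := (counit H).

Record cleaving (g : {linear H -> B}) : Prop := Cleaving {
  cleaving_coact : forall h, R (g h) = \tsum_(h1, h2 <- D h) (g h1 \ox h2);
  cleaving_aut : forall h, g (alpha h) = beta (g h);
  cleaving_bij : bijective (basis_map g) }.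

Lemma basis_map_aut g t :
  cleaving g -> basis_map g (free_aut H A t) = beta (basis_map g t).
Proof.
case=> _ g_aut _; move: t.
apply: eq_tensor => [||a h]; [exact/linear_comp/linearP..|].
by rewrite /= tmapE !basis_mapE g_aut aut_omul -inc_aut.
Qed.

(** The twisted isomorphism is beta composed with the untwisted one: untwisting
    turns the action of A on A (x) H into b (x) h |-> beta^-1(a) b (x) h, and
    the automorphism of A (x) H identifies this module with the usual one. *)
Lemma cleaving_of_iso (f : {linear tensor A H -> B}) :
  bijective f -> @is_lmod_map k A (free_lmod H A) (ca_lmod B) f ->
  @is_comod_map k H (free_comod H A) (ca_comod B) f ->
  exists g, cleaving g /\ forall t, f t = beta (basis_map g t).
Proof.
move=> fB [f_aut f_act] [_ f_coact].
pose g0 h := ainv beta (f (ha_one A \ox h)).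
have g0P : linear g0 by rewrite /g0; lin.
pose g := linear_of g0P.
have gE h : g h = ainv beta (f (ha_one A \ox h)) by [].
clearbody g.
have g_ainv h : f (ha_one A \ox ainv alpha h) = g h.
  apply: (can_inj (autK beta)); rewrite gE ainvK -[LHS]f_aut /=.
  by rewrite tmapE ainvK (haut1 A).
have fE : f =1 beta \o basis_map g.
  apply: eq_tensor => [||a h]; [exact: linearP|exact: linearP|].
  rewrite /= basis_mapE -mulE -g_ainv -[RHS]f_act /=.
  by rewrite free_actE ainvK (hmul1 A) ainvK.
exists g; split=> //; split=> [h|h|].
- rewrite gE /ocoact ainvK [LHS]f_coact /= free_coactE tsum_tsum; last by lin.
  rewrite sum_comul; last by split=> u; apply: tsum_comp_linear; lin.
  by apply: eq_tsum => x y; rewrite tsum_tens ?ainvK ?ainv1 ?g_ainv //; lin.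
- by rewrite -g_ainv autK gE ainvK.
- apply: (eq_bij (bij_comp (Bijective (ainvK beta) (autK beta)) fB)) => t.
  by rewrite /= fE /= autK.
Qed.

Lemma iso_of_cleaving (g : {linear H -> B}) (f : {linear tensor A H -> B}) :
  cleaving g -> (forall t, f t = beta (basis_map g t)) ->
  [/\ bijective f, @is_lmod_map k A (free_lmod H A) (ca_lmod B) f
    & @is_comod_map k H (free_comod H A) (ca_comod B) f].
Proof.
move=> cg fE; have [g_coact g_aut gB] := cg.
have f_aut t : f (free_aut H A t) = beta (f t) by rewrite !fE basis_map_aut.
split.
- exact: (eq_bij (bij_comp (Bijective (autK beta) (ainvK beta)) gB)).
- split=> // a t; rewrite -[RHS]/(inc a \mul f t) mulE fE /=.
  rewrite fE; congr (beta _); move: t.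
  apply: eq_tensor => [||b h]; [exact/linear_comp/linearPr|lin|].
  rewrite free_actE !basis_mapE g_aut aut_omul omulA -inc_aut -inc_omul.
  by rewrite -[a \ast _]mul_ainv autK.
split=> // t; rewrite -[LHS]/(coact B (f t)) fE -/(R (basis_map g t)).
move: t; apply: eq_tensor => [||a h].
- exact/linear_comp/linearP.
- by apply: tsum_comp_linear; [lin|exact: linearP].
rewrite basis_mapE ocoact_incl g_coact tsum_tsum; last by lin.
rewrite /= free_coactE tsum_tsum; last by lin.
rewrite sum_comul; last by split=> u; apply: tsum_comp_linear; lin.
apply: eq_tsum => x y; rewrite tsum_tens; last by lin.
rewrite tsum_tens; last by lin.
by rewrite ainvK fE basis_mapE aut_omul -inc_aut -g_aut !ainvK.
Qed.

Lemma normal_basis_cleaving : has_normal_basis B <-> exists g, cleaving g.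
Proof.
split=> [[f [fB f_lmod f_comod]] | [g cg]].
  have [F [FK KF]] := bij_linear_inv fB.
  have [|||g [cg _]] := @cleaving_of_iso F; last by exists g.
  - by exists f.
  - exact: (@lmod_map_inv k A (ca_lmod B) (free_lmod H A) f F FK KF f_lmod).
  - exact: (@comod_map_inv k H (ca_comod B) (free_comod H A) f F FK KF f_comod).
pose f : {linear tensor A H -> B} := (beta \o basis_map g).
have fE t : f t = beta (basis_map g t) by [].
clearbody f.
have [fB f_lmod f_comod] := iso_of_cleaving cg fE.
have [F [FK KF]] := bij_linear_inv fB.
exists F; split; first by exists f.
  exact: (@lmod_map_inv k A (free_lmod H A) (ca_lmod B) f F FK KF f_lmod).
exact: (@comod_map_inv k H (free_comod H A) (ca_comod B) f F FK KF f_comod).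
Qed.

(** * The action and the cocycle of a cleaving map *)

Section Projection.
Variable g : {linear H -> B}.
Hypothesis cg : cleaving g.

Lemma cleaving_ext (V : lmodType k) (f f' : B -> V) : linear f -> linear f' ->
  (forall a h, f (inc a \ast g h) = f' (inc a \ast g h)) -> f =1 f'.
Proof.
move=> fP fP' ff' b; have [n' _ nK] := cleaving_bij cg; rewrite -[b]nK.
move: (n' b); apply: eq_tensor => [c x y|c x y|a h].
- by rewrite linearP fP.
- by rewrite linearP fP'.
- by rewrite !basis_mapE ff'.
Qed.

Lemma ex_projection :
  exists p : {linear B -> A}, forall a h, p (inc a \ast g h) = eps h *: a.
Proof.
have [n [nK Kn]] := bij_linear_inv (cleaving_bij cg).
have EP : bilinear_for *:%R *:%R (fun (a : A) (h : H) => eps h *: a).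
  by split=> u c x y; rewrite ?linearP //= ?scalerDr ?scalerDl ?scalerA // mulrC.
pose p0 b := \tsum_(a, h <- n b) (eps h *: a).
have p0P : linear p0 by apply: tsum_comp_linear => //; exact: linearP.
exists (linear_of p0P) => a h.
by rewrite /= /p0 -basis_mapE nK (tsum_tens _ _ EP).
Qed.

Variable p : {linear B -> A}.
Hypothesis pE : forall a h, p (inc a \ast g h) = eps h *: a.

Lemma projection_g h : p (g h) = eps h *: ha_one A.
Proof. by rewrite -[g h]omul1l -inc1 pE. Qed.

Lemma projection_act a b : p (inc a \ast b) = a \ast p b.
Proof.
move: b; apply: cleaving_ext => [||b h]; [lin|lin|].
by rewrite omulA -inc_omul !pE linearZr_LR.
Qed.

Lemma projection_aut b : p (beta b) = ha_aut A (p b).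
Proof.
move: b; apply: cleaving_ext => [||b h]; [exact/linear_comp/linearP..|].
rewrite aut_omul -inc_aut -(cleaving_aut cg) !pE linearZ /=.
by rewrite (hcounit_aut (hopf_coalg H)).
Qed.

(** By A-linearity and colinearity it suffices to look at b = g(h), where this
    is the counit axiom. *)
Lemma projection_expand b : \tsum_(b0, b1 <- R b) (inc (p b0) \ast g b1) = b.
Proof.
move: b; apply: cleaving_ext => [||a h].
- by apply: tsum_comp_linear; [lin|exact: linearP].
- by [].
rewrite ocoact_incl tsum_tsum; last by lin.
rewrite (cleaving_coact cg) tsum_tsum; last first.
  by split=> u; apply: tsum_comp_linear; lin.
rewrite -(ocounitl (F := fun h => inc a \ast g h)); last by lin.
apply: eq_tsum => x y.
rewrite tsum_tens; last by split=> u; apply: tsum_comp_linear; lin.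
by rewrite tsum_tens ?pE ?[inc _]linearZ ?linearZl_LR //; lin.
Qed.

Definition cocycle (h l : H) : A := p (g h \ast g l).

Fact cocycle_bilinear : bilinear_for *:%R *:%R cocycle.
Proof. by rewrite /cocycle; lin. Qed.
HB.instance Definition _ :=
  bilinear_isBilinear.Build k H H A *:%R *:%R cocycle cocycle_bilinear.

Lemma ocoact_cleaving_mul h l : R (g h \ast g l) =
  \tsum_(h1, h2 <- D h) \tsum_(l1, l2 <- D l) ((g h1 \ast g l1) \ox (h2 \ast l2)).
Proof.
rewrite ocoact_mul !(cleaving_coact cg).
under eq_tsum => x0 x1.
  rewrite tsum_tsum; last by lin.
  under eq_tsum => l1 l2 do (rewrite tsum_tens; last by lin).
  over.
rewrite tsum_tsum; last by lin.
by apply: eq_tsum => h1 h2; rewrite tsum_tens; last by lin.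
Qed.

Lemma cocycleE h l : g h \ast g l =
  \tsum_(h1, h2 <- D h) \tsum_(l1, l2 <- D l)
    (inc (cocycle h1 l1) \ast g (h2 \ast l2)).
Proof.
have G : bilinear_for *:%R *:%R (fun (b0 : B) (b1 : H) => inc (p b0) \ast g b1).
  by lin.
rewrite -[LHS]projection_expand ocoact_cleaving_mul tsum_tsum //.
apply: eq_tsum => h1 h2; rewrite tsum_tsum //.
by apply: eq_tsum => l1 l2; rewrite tsum_tens.
Qed.

Definition action (h : H) (a : A) : A := p (g h \ast inc a).

Fact action_bilinear : bilinear_for *:%R *:%R action.
Proof. by rewrite /action; lin. Qed.
HB.instance Definition _ :=
  bilinear_isBilinear.Build k H A A *:%R *:%R action action_bilinear.

Lemma actionE h a :
  g h \ast inc a = \tsum_(h1, h2 <- D h) (inc (action h1 a) \ast g h2).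
Proof.
have G : bilinear_for *:%R *:%R (fun (b0 : B) (b1 : H) => inc (p b0) \ast g b1).
  by lin.
have Rga : R (g h \ast inc a) = \tsum_(h1, h2 <- D h) ((g h1 \ast inc a) \ox h2).
  rewrite ocoact_mul (cleaving_coact cg) ocoact_inc.
  under eq_tsum => x0 x1 do (rewrite tsum_tens; last by lin).
  rewrite tsum_tsum; last by lin.
  by apply: eq_tsum => h1 h2; rewrite tsum_tens ?omul1r //; lin.
rewrite -[LHS]projection_expand Rga tsum_tsum //.
by apply: eq_tsum => h1 h2; rewrite tsum_tens.
Qed.

Lemma action1 h : action h (ha_one A) = eps h *: ha_one A.
Proof. by rewrite /action inc1 omul1r projection_g. Qed.

Lemma action_mul h a b :
  action h (a \ast b) = \tsum_(h1, h2 <- D h) (action h1 a \ast action h2 b).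
Proof.
rewrite /action inc_omul omulA actionE bil_tsuml linear_tsum.
by apply: eq_tsum => h1 h2; rewrite /= -omulA projection_act.
Qed.

Lemma action_aut h a : ha_aut A (action h a) = action (alpha h) (ha_aut A a).
Proof. by rewrite /action -projection_aut aut_omul -(cleaving_aut cg). Qed.

End Projection.

(** The element u = g(1) is coinvariant, and equals s(1, 1) for the cocycle s
    of g, so its inverse is the value at (1, 1) of the convolution inverse of
    s.  Dividing g by u normalises it. *)
Lemma cleaving_normalise g : is_galois B -> cleaving g ->
  exists g', cleaving g' /\ g' (ha_one H) = ha_one B.
Proof.
move=> galB cg; have [p pE] := ex_projection cg.
have [g_coact g_aut gB] := cg.
have [t st] := (galois_iff_conv g_coact (cocycleE cg pE) gB).1 galB.
have [u gu] : exists u, g (ha_one H) = inc u.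
  by apply: coinv_inc; rewrite g_coact ocomul1 tsum_tens; last by lin.
have s11 : cocycle g p (ha_one H) (ha_one H) = u.
  by rewrite /cocycle {1}gu pE counit1 scale1r.
pose v := t (ha_one H) (ha_one H).
have [uv vu] : u \ast v = ha_one A /\ v \ast u = ha_one A.
  have [] := st (ha_one H) (ha_one H).
  rewrite /conv !ocomul1 counit1 mul1r scale1r.
  rewrite tsum_tens; last by split=> ?; apply: tsum_param; lin.
  rewrite tsum_tens; last by lin.
  rewrite tsum_tens; last by split=> ?; apply: tsum_param; lin.
  rewrite tsum_tens; last by lin.
  by move=> /= E1 E2; rewrite -s11; split.
have u_aut : ha_aut A u = u.
  by apply: inc_inj; rewrite inc_aut -gu -g_aut (haut1 H).
have v_aut : ha_aut A v = v.
  by rewrite -[RHS]omul1r -(haut1 A) -uv aut_omul u_aut omulA vu omul1l.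
have g'P : linear (fun h => inc v \ast g h) by lin.
pose g' := linear_of g'P.
have g'E h : g' h = inc v \ast g h by [].
clearbody g'; exists g'; split; last by rewrite g'E gu -inc_omul vu.
have rP : linear (fun a : A => a \ast v) by lin.
pose r := linear_of rP.
have rE a : r a = a \ast v by [].
have rB : bijective r.
  by exists (fun a => a \ast u) => a; rewrite rE -omulA ?vu ?uv omul1r.
clearbody r.
have g'_basis : basis_map g' =1 basis_map g \o tmap r (@idfun H).
  apply: eq_tensor => [||a h]; [lin|exact/linear_comp/linearP|].
  by rewrite basis_mapE g'E /= tmapE basis_mapE rE inc_omul omulA.
split=> [h|h|].
- rewrite g'E ocoact_incl g_coact tsum_tsum; last by lin.
  by apply: eq_tsum => x y; rewrite tsum_tens ?g'E //; lin.
- by rewrite !g'E g_aut aut_omul -inc_aut v_aut.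
apply: (@eq_bij _ _ (basis_map g \o tmap r (@idfun H))) => [|x].
  by apply: bij_comp => //; apply: tmap_bij => //; exists id.
by rewrite g'_basis.
Qed.

End Cleaving.

(** * Crossed products *)

Section UntwistedCocycle.
Variables (k : fieldType) (H : homHopf k) (A : homAlg k).
Local Notation alpha := (ha_aut H).
Local Notation beta := (ha_aut A).
Local Notation D := (@ocomul k H).
Local Notation eps := (counit H).
Implicit Types s t : {bilinear H -> H -> A}.

Section Twists.
Variable s : {bilinear H -> H -> A}.

(** Removing the automorphisms from the product of the crossed product leaves
    this map in place of s; see [crossed_mul_untwist]. *)
Definition cocycle_untwist (h l : H) : A :=
  beta (s (ainv alpha (ainv alpha h)) (ainv alpha (ainv alpha l))).

Fact cocycle_untwist_bilinear : bilinear_for *:%R *:%R cocycle_untwist.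
Proof. by rewrite /cocycle_untwist; lin. Qed.
HB.instance Definition _ :=
  bilinear_isBilinear.Build k H H A *:%R *:%R
    cocycle_untwist cocycle_untwist_bilinear.

Definition cocycle_retwist (h l : H) : A :=
  ainv beta (s (alpha (alpha h)) (alpha (alpha l))).

Fact cocycle_retwist_bilinear : bilinear_for *:%R *:%R cocycle_retwist.
Proof. by rewrite /cocycle_retwist; lin. Qed.
HB.instance Definition _ :=
  bilinear_isBilinear.Build k H H A *:%R *:%R
    cocycle_retwist cocycle_retwist_bilinear.

End Twists.

Lemma cocycle_retwistK s h l : cocycle_untwist (cocycle_retwist s) h l = s h l.
Proof. by rewrite /cocycle_untwist /= /cocycle_retwist !ainvK. Qed.

Lemma conv_untwist s t h l :
  \tsum_(h1, h2 <- comul H h) \tsum_(l1, l2 <- comul H l) (s h1 l1 \mul t h2 l2)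
  = conv (cocycle_untwist s) (cocycle_untwist t) (alpha h) (alpha l).
Proof.
rewrite /conv sum_ocomul_aut; last by lin.
rewrite sum_comul; last by lin.
apply: eq_tsum => h1 h2; rewrite sum_ocomul_aut; last by lin.
rewrite sum_comul; last by lin.
by apply: eq_tsum => l1 l2; rewrite /= /cocycle_untwist !autK mulE aut_omul.
Qed.

Lemma conv_invertibleE s :
  conv_invertible s <-> exists t, conv_inverse (cocycle_untwist s) t.
Proof.
split=> [[t st] | [t st]].
  exists (cocycle_untwist t) => h l.
  have [] := st (ainv alpha h) (ainv alpha l).
  by rewrite !conv_untwist !ainvK !counit_ainv.
exists (cocycle_retwist t) => h l; have [E1 E2] := st (alpha h) (alpha l).
have -> : (eps h * eps l) *: ha_one A = (eps (alpha h) * eps (alpha l)) *: ha_one A.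
  by rewrite !(hcounit_aut (hopf_coalg H)).
rewrite !conv_untwist; split.
  rewrite -E1 /conv; apply: eq_tsum => h1 h2; apply: eq_tsum => l1 l2.
  by rewrite /= cocycle_retwistK.
rewrite -E2 /conv; apply: eq_tsum => h1 h2; apply: eq_tsum => l1 l2.
by rewrite /= cocycle_retwistK.
Qed.

Variables (act : {bilinear H -> A -> A}) (s : {bilinear H -> H -> A}).

Lemma crossed_mulE a h b l :
  crossed_mul act s (a \ox h) (b \ox l) = crossed_mul4 act s a h b l.
Proof.
rewrite /crossed_mul /crossed_mul4 tsum_tens; last by lin.
by rewrite tsum_tens; last by lin.
Qed.

(** Up to the automorphism of A (x) H, the product is the classical one
    (a # h)(b # l) = sum a (h_1 . b) s(h_2, l_1) # h_3 l_2, for the action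
    beta^-1(h . b) and the untwisted cocycle. *)
Lemma crossed_mul_untwist a h b l : is_weak_action act ->
  crossed_mul act s (a \ox h) (b \ox l) =
  free_aut H A (\tsum_(x, y <- D h) \tsum_(y1, y2 <- D y) \tsum_(l1, l2 <- D l)
    ((a \ast (ainv beta (act x b) \ast cocycle_untwist s y1 l1))
     \ox (y2 \ast l2))).
Proof.
move=> wact; rewrite crossed_mulE /crossed_mul4.
rewrite sum_comul; last by lin.
rewrite [RHS]linear_tsum; apply: eq_tsum => x y.
rewrite sum_comul; last by lin.
rewrite sum_ocomul_ainv; last by lin.
rewrite [RHS]linear_tsum; apply: eq_tsum => y1 y2.
rewrite sum_comul; last by lin.
rewrite [RHS]linear_tsum; apply: eq_tsum => l1 l2 /=.
rewrite tmapE !ainvK -mul_ainv; congr ((_ \mul (_ \mul _)) \ox _); last first.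
  by rewrite /cocycle_untwist autK.
by do 2!apply: (can_inj (autK beta)); rewrite !(wact_aut wact) !ainvK.
Qed.

End UntwistedCocycle.

Lemma hom_alg_pullback (k : fieldType) (X : homAlgData k) (C : homAlg k)
    (f : {linear X -> C}) :
  injective f -> is_hom_alg_map f -> is_hom_alg X.
Proof.
move=> fI [fa fm f1]; split=> *; apply: fI; rewrite ?(fa, fm, f1) //.
- exact: hmulA C _ _ _.
- exact: hmul1 C _.
- exact: h1mul C _.
- exact: haut_mul C _ _.
- exact: haut1 C.
Qed.

Section CrossedIso.
Variables (k : fieldType) (H : homHopf k) (B : homComodAlg H).
Local Notation beta := (ha_aut B).
Local Notation A := (coinv_alg B).
Local Notation D := (@ocomul k H).
Local Notation eps := (counit H).
Variables (act : {bilinear H -> A -> A}) (s : {bilinear H -> H -> A}).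
Hypothesis wact : is_weak_action act.

(** Multiplicativity at (1 # h)(1 # l), where the action is trivial. *)
Lemma crossed_iso_cocycle (f : {linear crossed_product act s -> B}) :
  is_crossed_iso f -> exists g, cleaving g /\
    forall h l, g h \ast g l = \tsum_(h1, h2 <- D h) \tsum_(l1, l2 <- D l)
      (inc (cocycle_untwist s h1 l1) \ast g (h2 \ast l2)).
Proof.
move=> [fB [_ f_mul _] f_lmod f_comod].
have [g [cg fE]] := @cleaving_of_iso k H B f fB f_lmod f_comod.
exists g; split=> // h l.
apply: (can_inj (autK beta)); apply: (can_inj (autK beta)).
have := f_mul (ha_one A \ox h) (ha_one A \ox l).
rewrite !fE !basis_mapE inc1 !omul1l mulE -aut_omul => <-.
rewrite [_ \mul _](crossed_mul_untwist _ _ _ _ _ wact) basis_map_aut //.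
congr (beta (beta _)).
(* The action on 1 is the counit: the triple coproduct collapses on its first
   factor. *)
rewrite -(ocounitl (F := fun h => \tsum_(h1, h2 <- D h) \tsum_(l1, l2 <- D l)
      (inc (cocycle_untwist s h1 l1) \ast g (h2 \ast l2)))); last by lin.
rewrite linear_tsum; apply: eq_tsum => x y; rewrite /= tsumZ linear_tsum.
apply: eq_tsum => y1 y2; rewrite /= tsumZ linear_tsum; apply: eq_tsum => l1 l2.
have -> : ainv (ha_aut A) (act x (ha_one A)) = eps x *: ha_one A.
  by rewrite (wact1 wact) [LHS]linearZ; congr (_ *: _); exact: ainv1 A.
by rewrite linearZl_LR linearZr_LR linearZl_LR linearZ /= basis_mapE !omul1l.
Qed.

Variable g : {linear H -> B}.
Hypothesis cg : cleaving g.
Hypothesis g_act : forall h a, g h \ast inc a =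
  \tsum_(h1, h2 <- D h) (inc (ainv (ha_aut A) (act h1 a)) \ast g h2).
Hypothesis g_mul : forall h l, g h \ast g l =
  \tsum_(h1, h2 <- D h) \tsum_(l1, l2 <- D l)
    (inc (cocycle_untwist s h1 l1) \ast g (h2 \ast l2)).

(** Expand a g(h) b g(l), moving g(h) first past b and then past g(l). *)
Lemma basis_map_crossed x y :
  basis_map g (crossed_mul act s x y) = beta (basis_map g x \ast basis_map g y).
Proof.
move: x; apply: eq_tensor => [||a h].
- by move=> c u v; rewrite linearPl linearP.
- by move=> c u v; rewrite linearP linearPl linearP.
move: y; apply: eq_tensor => [||b l].
- by move=> c u v; rewrite linearPr linearP.
- by move=> c u v; rewrite linearP linearPr linearP.
rewrite crossed_mul_untwist // basis_map_aut //; congr (beta _).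
rewrite !basis_mapE -omulA [g h \ast _]omulA g_act bil_tsuml bil_tsumr linear_tsum.
apply: eq_tsum => x y /=; rewrite -[_ \ast g y \ast _]omulA g_mul.
rewrite !bil_tsumr linear_tsum.
apply: eq_tsum => y1 y2 /=; rewrite !bil_tsumr linear_tsum.
by apply: eq_tsum => l1 l2 /=; rewrite basis_mapE !inc_omul !omulA.
Qed.

Hypothesis g1 : g (ha_one H) = ha_one B.

Lemma crossed_iso_of_cleaving (f : {linear crossed_product act s -> B}) :
  (forall t, f t = beta (basis_map g t)) ->
  is_hom_alg (crossed_product act s) /\ is_crossed_iso f.
Proof.
move=> fE; have [fB f_lmod f_comod] := @iso_of_cleaving k H B g f cg fE.
have f_alg : is_hom_alg_map f.
  split=> [x|x y|].
  - by rewrite !fE; congr (beta _); exact: basis_map_aut.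
  - rewrite !fE [_ \mul _ in LHS]/(crossed_mul act s x y).
    by rewrite basis_map_crossed mulE aut_omul.
  - by rewrite fE basis_mapE inc1 g1 omul1l (haut1 B).
by split; [exact: (@hom_alg_pullback _ _ B f (bij_inj fB) f_alg) | split].
Qed.

End CrossedIso.

Theorem corollary5p4 (k : fieldType) (H : homHopf k) (B : homComodAlg H) :
  is_galois B /\ has_normal_basis B <->
  exists (act : {bilinear H -> coinv_alg B -> coinv_alg B})
         (sigma : {bilinear H -> H -> coinv_alg B}),
    [/\ is_weak_action act,
        conv_invertible sigma,
        is_hom_alg (crossed_product act sigma)
      & exists f : {linear crossed_product act sigma -> B}, is_crossed_iso f].
Proof.
split=> [[galB /normal_basis_cleaving[g0 cg0]] |
         [act [s [wact sI _ [f fP]]]]]; last first.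
  have [g [cg g_mul]] := crossed_iso_cocycle wact fP.
  split; last by apply/normal_basis_cleaving; exists g.
  apply/(galois_iff_conv (cleaving_coact cg) g_mul (cleaving_bij cg)).
  exact/conv_invertibleE.
have [g [cg g1]] := cleaving_normalise galB cg0.
have [p pE] := ex_projection cg.
(* The twists are those that [crossed_mul_untwist] removes. *)
pose act0 h a := ha_aut (coinv_alg B) (action g p h a).
have act0P : bilinear_for *:%R *:%R act0 by rewrite /act0; lin.
pose act : {bilinear H -> coinv_alg B -> coinv_alg B} :=
  HB.pack act0 (bilinear_isBilinear.Build k H _ _ *:%R *:%R act0 act0P).
have actE h a : act h a = ha_aut (coinv_alg B) (action g p h a) by [].
clearbody act.
pose s : {bilinear H -> H -> coinv_alg B} := cocycle_retwist (cocycle g p).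
have sE h l : cocycle_untwist s h l = cocycle g p h l.
  exact: cocycle_retwistK.
clearbody s.
have g_mul h l : g h \ast g l =
    \tsum_(h1, h2 <- ocomul h) \tsum_(l1, l2 <- ocomul l)
      (inc (cocycle_untwist s h1 l1) \ast g (h2 \ast l2)).
  rewrite (cocycleE cg pE); apply: eq_tsum => ? ?; apply: eq_tsum => ? ?.
  by rewrite sE.
have wact : is_weak_action act.
  split=> [h a|h|h a b].
  - by rewrite !actE -(action_aut cg pE).
  - rewrite actE (action1 pE) [LHS]linearZ; congr (_ *: _).
    exact: (haut1 (coinv_alg B)).
  - rewrite actE mulE aut_omul (action_mul cg pE) linear_tsum.
    rewrite [RHS]sum_comul; last by lin.
    apply: eq_tsum => x y; rewrite [RHS]mulE; congr (ha_aut _ (_ \ast _)).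
      by rewrite actE (action_aut cg pE) ainvK.
    by rewrite actE (action_aut cg pE) ainvK.
have g_act h a : g h \ast inc a = \tsum_(h1, h2 <- ocomul h)
    (inc (ainv (ha_aut (coinv_alg B)) (act h1 a)) \ast g h2).
  by rewrite (actionE cg pE); apply: eq_tsum => x y; rewrite actE autK.
pose f : {linear crossed_product act s -> B} := ha_aut B \o basis_map g.
have [crossedP fP] :=
  crossed_iso_of_cleaving wact cg g_act g_mul g1 (fun t => erefl (f t)).
exists act, s; split=> //; last by exists f.
apply/conv_invertibleE.
exact/(galois_iff_conv (cleaving_coact cg) g_mul (cleaving_bij cg)).
Qed.
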